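(* Let $\mathcal H$ be a real Hilbert space, let $z\in\mathcal H$, let $f\colon\mathcal H\to\,]-\infty,+\infty]$ be proper, lower semicontinuous and convex, let $\varnothing\ne\mathbb K\subset\mathbb N$, let $(e_k)_{k\in\mathbb K}$ be a (finite or infinite) sequence of unit norm vectors in $\mathcal H$, and let $\delta\in\,]0,+\infty[$ be such that $$(\forall x\in\mathcal H)\quad\sum_{k\in\mathbb K}|\langle x\mid e_k\rangle|^2\le\delta\|x\|^2.$$ Let $(\phi_k)_{k\in\mathbb K}$ be proper lower semicontinuous convex functions from $\mathbb R$ to $]-\infty,+\infty]$ such that $(\forall k\in\mathbb K)$ $\phi_k\ge\phi_k(0)=0$ and $$0\in\operatorname{sri}\Big\{\big(\langle x\mid e_k\rangle-\xi_k\big)_{k\in\mathbb K}\;:\;(\xi_k)_{k\in\mathbb K}\in\ell^2(\mathbb K),\;\sum_{k\in\mathbb K}\phi_k(\xi_k)<+\infty,\;x\in\operatorname{dom}f\Big\}.$$ Let $x$ be the unique solution to the problem $$\underset{x\in\mathcal H}{\text{minimize}}\;\;f(x)+\sum_{k\in\mathbb K}\phi_k(\langle x\mid e_k\rangle)+\tfrac12\|x-z\|^2,$$ and consider the dual problem $$\underset{(\nu_k)_{k\in\mathbb K}\in\ell^2(\mathbb K)}{\text{minimize}}\;\;\widetilde{f^*}\Big(z-\sum_{k\in\mathbb K}\nu_ke_k\Big)+\sum_{k\in\mathbb K}\phi_k^*(\nu_k).\qquad (D)$$ Let $((\alpha_{n,k})_{n\in\mathbb N})_{k\in\mathbb K}$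 be sequences in $\mathbb R$ such that $\sum_{n\in\mathbb N}\sqrt{\sum_{k\in\mathbb K}|\alpha_{n,k}|^2}<+\infty$, let $(b_n)_{n\in\mathbb N}$ be a sequence in $\mathcal H$ such that $\sum_{n\in\mathbb N}\|b_n\|<+\infty$, let $\varepsilon\in\,]0,\min\{1,\delta^{-1}\}[$, let $(\nu_{0,k})_{k\in\mathbb K}\in\ell^2(\mathbb K)$, let $(\gamma_n)_{n\in\mathbb N}$ be a sequence in $[\varepsilon,2\delta^{-1}-\varepsilon]$, let $(\lambda_n)_{n\in\mathbb N}$ be a sequence in $[\varepsilon,1]$, and define, for every $n\in\mathbb N$, $$x_n=\operatorname{prox}_f\Big(z-\sum_{k\in\mathbb K}\nu_{n,k}e_k\Big)+b_n$$ and, for every $k\in\mathbb K$, $$\nu_{n+1,k}=\nu_{n,k}+\lambda_n\Big(\operatorname{prox}_{\gamma_n\phi_k^*}\big(\nu_{n,k}+\gamma_n\langle x_n\mid e_k\rangle\big)+\alpha_{n,k}-\nu_{n,k}\Big).$$ Set $v_n=(\nu_{n,k})_{k\in\mathbb K}$. Then the following hold. (i) $(v_n)_{n\in\mathbb N}$ converges weakly in $\ell^2(\mathbb K)$ to a solution $(\nu_k)_{k\in\mathbb K}$ to $(D)$, and $x=\operatorname{prox}_f\big(z-\sum_{k\in\mathbb K}\nu_ke_k\big)$. (ii) $(x_n)_{n\in\mathbb N}$ converges strongly to $x$.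
   Context: For a function $\varphi$ with values in $]-\infty,+\infty]$, $\operatorname{dom}\varphi=\{x : \varphi(x)<+\infty\}$. For a nonempty convex set $S$ in a Hilbert space, $\operatorname{cone}S=\bigcup_{\lambda>0}\{\lambda x: x\in S\}$, and the strong relative interior is $\operatorname{sri}S=\{x\in S:\operatorname{cone}(S-x)=\overline{\operatorname{span}}(S-x)\}$, where $\overline{\operatorname{span}}$ is the closed linear span; here it is taken in the Hilbert space $\ell^2(\mathbb K)$. For $\varphi$ proper, lower semicontinuous and convex on a real Hilbert space: $\varphi^*(u)=\sup_x\langle x\mid u\rangle-\varphi(x)$ is its conjugate; $\widetilde{\varphi}(x)=\min_y\varphi(y)+\frac12\|x-y\|^2$ is its Moreau envelope (so $\widetilde{f^*}$ is the Moreau envelope of $f^*$); and $\operatorname{prox}_\varphi x$ is the unique minimizer of $y\mapsto\varphi(y)+\frac12\|x-y\|^2$. *)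

(* Defs.v *)
From HB Require Import structures.
From mathcomp Require Import all_boot all_order all_algebra.
From mathcomp Require Import sesquilinear ring.
From mathcomp Require Import all_classical all_reals all_analysis.

Set Implicit Arguments.
Unset Strict Implicit.
Unset Printing Implicit Defensive.

Import Order.TTheory GRing.Theory Num.Theory.
Import numFieldNormedType.Exports.

Local Open Scope classical_set_scope.
Local Open Scope ring_scope.

Section optimization.
Context {T : Type} {R : realType}.
Implicit Type F : T -> \bar R.

Definition dom F : set T := [set x | (F x < +oo)%E].

Definition argmin F : set T := [set x | forall y, (F x <= F y)%E].

End optimization.

Section convex_analysis.
Context {R : realType} {V : normedModType R}.
Implicit Types (phi : V -> \bar R) (S : set V).

Definition Gamma0 phi : Prop :=
  [/\ forall x, phi x != -oo%E,
      dom phi !=set0,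
      lower_semicontinuous phi &
      forall (x y : V) (t : R), 0 < t < 1 ->
        (phi (t *: x + (1 - t) *: y)%R <= t%:E * phi x + (1 - t)%R%:E * phi y)%E].

Definition conjugate (ip : V -> V -> R) phi (u : V) : \bar R :=
  ereal_sup [set ((ip x u)%:E - phi x)%E | x in [set: V]].

Definition prox_obj phi (x y : V) : \bar R :=
  (phi y + (2^-1 * `|x - y| ^+ 2)%R%:E)%E.

(* The infimum is attained when [phi] is proper, lower semicontinuous and
   convex on a Hilbert space. *)
Definition moreau phi (x : V) : \bar R :=
  ereal_inf [set prox_obj phi x y | y in [set: V]].

(* [xget] selects the unique minimizer; the default value 0 is only returned
   when there is no unique minimizer. *)
Definition prox phi (x : V) : V :=
  xget 0 [set p | argmin (prox_obj phi x) = [set p]].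

Definition cone S : set V :=
  \bigcup_(l in [set l : R | 0 < l]) [set l *: x | x in S].

Definition lin_span S : set V :=
  [set y | exists n (a : 'I_n -> R) (u : 'I_n -> V),
     (forall i, S (u i)) /\ y = \sum_(i < n) a i *: u i].

Definition sri S : set V :=
  [set x | S x /\ cone [set y - x | y in S]
                  = closure (lin_span [set y - x | y in S])].

Definition weak_cvg (ip : V -> V -> R) (u : nat -> V) (l : V) : Prop :=
  forall y, ip (u n) y @[n --> \oo] --> ip l y.

End convex_analysis.

(* The sum of the family (u_k)_{k \in K} in the order of the indices;
   meaningful only when the partial sums converge. *)
Definition vsum {R : realType} {V : normedModType R} (K : set nat)
    (u : nat -> V) : V :=
  limn (fun n => \sum_(0 <= k < n | k \in K) u k).

(* l^2(K) is represented by the square-summable real sequences indexed by [nat]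
   that vanish outside [K]. *)
Definition l2_pred (R : realType) (K : set nat) : {pred nat -> R} :=
  fun v => `[< (forall k, ~ K k -> v k = 0) /\
               cvgn (series (fun k => v k ^+ 2)) >].
Arguments l2_pred : clear implicits.

Section l2_submod.
Context (R : realType) (K : set nat).

Lemma l2_predP (v : nat -> R) :
  reflect ((forall k, ~ K k -> v k = 0) /\
           cvgn (series (fun k => v k ^+ 2))) (v \in l2_pred R K).
Proof. exact: asboolP. Qed.

Lemma is_cvg_series_mul (v w : nat -> R) :
  cvgn (series (fun k => v k ^+ 2)) -> cvgn (series (fun k => w k ^+ 2)) ->
  cvgn (series (fun k => v k * w k)).
Proof.
move=> cv cw; apply: normed_cvg.
apply: (@series_le_cvg _ _ ((fun k => v k ^+ 2) + (fun k => w k ^+ 2))).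
- by move=> k; exact: normr_ge0.
- by move=> k; rewrite addr_ge0 ?sqr_ge0.
- move=> k; change (`|v k * w k| <= v k ^+ 2 + w k ^+ 2).
  rewrite -subr_ge0 normrM -[v k ^+ 2]real_normK ?num_real//.
  rewrite -[w k ^+ 2]real_normK ?num_real//.
  have -> : `|v k| ^+ 2 + `|w k| ^+ 2 - `|v k| * `|w k| =
     2^-1 * ((`|v k| - `|w k|) ^+ 2 + `|v k| ^+ 2 + `|w k| ^+ 2) by field.
  by rewrite mulr_ge0// !addr_ge0 ?sqr_ge0.
- exact: is_cvg_seriesD.
Qed.

Lemma l2_submod_closed : submod_closed (l2_pred R K).
Proof.
split.
  apply/l2_predP; split=> //.
  have -> : series (fun k : nat => (0 : nat -> R) k ^+ 2) = cst 0.
    by apply/funext => n; rewrite /series/= big1// => i _; rewrite expr0n.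
  exact: is_cvg_cst.
move=> a v w /l2_predP[v0 cv] /l2_predP[w0 cw]; apply/l2_predP; split.
  by move=> k Kk; rewrite !fctE v0// w0// scaler0 addr0.
have -> : (fun k => (a *: v + w) k ^+ 2) =
   (a ^+ 2) *: (fun k => v k ^+ 2) +
   ((2 * a) *: (fun k => v k * w k) + (fun k => w k ^+ 2)).
  by apply/funext => k; rewrite !fctE /GRing.scale/=; ring.
apply: is_cvg_seriesD; first exact: is_cvg_seriesZ.
apply: is_cvg_seriesD => //; apply: is_cvg_seriesZ.
exact: is_cvg_series_mul.
Qed.

HB.instance Definition _ :=
  GRing.isSubmodClosed.Build R (nat -> R) (l2_pred R K) l2_submod_closed.

Record l2 := L2 { l2val :> nat -> R; _ : l2val \in l2_pred R K }.

HB.instance Definition _ := [isSub for l2val].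
HB.instance Definition _ := [Choice of l2 by <:].
HB.instance Definition _ := [SubChoice_isSubLmodule of l2 by <:].

End l2_submod.

Section l2_dot.
Context {R : realType} {K : set nat}.
Implicit Types u v w : l2 R K.

Definition l2dot v w : R := limn (series (fun k => v k * w k)).

Lemma is_cvg_l2dot v w : cvgn (series (fun k => v k * w k)).
Proof.
by apply: is_cvg_series_mul;
  [case: v => v /= /l2_predP[]|case: w => w /= /l2_predP[]].
Qed.

Lemma l2dotC v w : l2dot v w = l2dot w v.
Proof.
by rewrite /l2dot; congr (limn (series _)); apply/funext => k; rewrite mulrC.
Qed.

Lemma l2dotPl a u v w : l2dot (a *: u + v) w = a * l2dot u w + l2dot v w.
Proof.
rewrite /l2dot; have -> : (fun k => (a *: u + v) k * w k) =
    a *: (fun k => u k * w k) + (fun k => v k * w k).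
  by apply/funext => k; rewrite !fctE /= mulrDl -mulrA.
have cu := @is_cvg_l2dot u w; have cv := @is_cvg_l2dot v w.
rewrite lim_seriesD//; last exact: is_cvg_seriesZ cu.
by rewrite lim_seriesZ.
Qed.

Let l2dot_bilinear : bilinear_for
  (GRing.Scale.Law.clone _ _ *%R _) (GRing.Scale.Law.clone _ _ (idfun \; *%R) _)
  l2dot.
Proof.
split=> [w a u v|w a u v] /=; first exact: l2dotPl.
by rewrite l2dotC l2dotPl !(l2dotC w).
Qed.

HB.instance Definition _ := bilinear_isBilinear.Build R (l2 R K) (l2 R K) R
  _ _ l2dot l2dot_bilinear.

Let l2dot_herm v w : l2dot v w = (-1) ^+ false * idfun (l2dot w v).
Proof. by rewrite expr0 mul1r; exact: l2dotC. Qed.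

HB.instance Definition _ := isHermitianSesquilinear.Build R (l2 R K)
  false idfun l2dot l2dot_herm.

Lemma le_l2dot v k : v k ^+ 2 <= l2dot v v.
Proof.
have cv := @is_cvg_l2dot v v.
have nd : nondecreasing_seq (series (fun k => v k * v k)).
  by apply: nondecreasing_series => i _ _; rewrite -expr2 sqr_ge0.
apply: le_trans (nondecreasing_cvgn_le nd cv k.+1).
rewrite /series/= big_nat_recr//= -expr2 lerDr sumr_ge0// => i _.
by rewrite -expr2 sqr_ge0.
Qed.

Let l2dot_gt0 v : v != 0 -> 0 < l2dot v v.
Proof.
move=> v0; rewrite lt_neqAle (le_trans _ (le_l2dot v 0%N)) ?sqr_ge0// andbT.
apply: contra v0 => /eqP vv0; apply/eqP/val_inj/funext => k /=.
apply/eqP; rewrite -sqrf_eq0 eq_le sqr_ge0 andbT vv0.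
exact: le_l2dot.
Qed.

HB.instance Definition _ := isDotProduct.Build R (l2 R K) l2dot l2dot_gt0.

Lemma l2dot_ge0 v : 0 <= l2dot v v.
Proof. by rewrite (le_trans _ (le_l2dot v 0%N)) ?sqr_ge0. Qed.

Definition l2norm v : R := Num.sqrt (l2dot v v).

Lemma l2dotDl u v w : l2dot (u + v) w = l2dot u w + l2dot v w.
Proof. by have := l2dotPl 1 u v w; rewrite scale1r mul1r. Qed.

Lemma l2dot0l w : l2dot 0 w = 0.
Proof. exact: linear0l. Qed.

Lemma l2dotZl a v w : l2dot (a *: v) w = a * l2dot v w.
Proof. by have := l2dotPl a v 0 w; rewrite l2dot0l !addr0. Qed.

Lemma l2dotDD v w :
  l2dot (v + w) (v + w) = l2dot v v + 2 * l2dot v w + l2dot w w.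
Proof.
rewrite l2dotDl (l2dotC v) (l2dotC w) !l2dotDl (l2dotC w v).
by ring.
Qed.

Lemma l2dotZZ a v : l2dot (a *: v) (a *: v) = a ^+ 2 * l2dot v v.
Proof. by rewrite l2dotZl l2dotC l2dotZl mulrA expr2. Qed.

Lemma l2dot_CauchySchwarz v w : l2dot v w <= l2norm v * l2norm w.
Proof.
have [->|v0] := eqVneq v 0; first by rewrite l2dot0l mulr_ge0 ?sqrtr_ge0.
have a0 : 0 < l2dot v v by exact: neq0_dnorm_gt0.
rewrite -sqrtrM ?l2dot_ge0// (le_trans (ler_norm _))// -sqrtr_sqr ler_wsqrtr//.
have := l2dot_ge0 (l2dot v v *: w + (- l2dot v w) *: v).
rewrite l2dotDD !l2dotZZ l2dotZl (l2dotC w) l2dotZl.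
set a := l2dot v v; set b := l2dot v w; set c := l2dot w w => h.
rewrite -subr_ge0 -(pmulr_rge0 _ a0) -/a; apply: le_trans h _.
by rewrite le_eqVlt; apply/orP; left; apply/eqP; ring.
Qed.

Let ler_l2normD v w : l2norm (v + w) <= l2norm v + l2norm w.
Proof.
have n0 : 0 <= l2norm v + l2norm w by rewrite addr_ge0 ?sqrtr_ge0.
rewrite -(@ler_pXn2r _ 2) ?nnegrE ?sqrtr_ge0// sqrrD.
rewrite !sqr_sqrtr ?l2dot_ge0// l2dotDD lerD2r lerD2l -[leRHS]mulr_natl ler_pM2l//.
exact: l2dot_CauchySchwarz.
Qed.

Let l2normZ a v : l2norm (a *: v) = `|a| * l2norm v.
Proof. by rewrite /l2norm l2dotZZ sqrtrM ?sqr_ge0// sqrtr_sqr. Qed.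

Let l2norm0_eq0 v : l2norm v = 0 -> v = 0.
Proof.
move=> /eqP; rewrite sqrtr_eq0; apply: contraTeq => v0.
by rewrite -ltNge; exact: neq0_dnorm_gt0.
Qed.

HB.instance Definition _ :=
  Lmodule_isNormed.Build R (l2 R K) ler_l2normD l2normZ l2norm0_eq0.

End l2_dot.

Lemma l2_norm_dot (R : realType) (K : set nat) (v : l2 R K) :
  l2dot v v = `|v| ^+ 2.
Proof. by rewrite sqr_sqrtr ?l2dot_ge0. Qed.

Definition conjugateR {R : realType} (phi : R^o -> \bar R) : R^o -> \bar R :=
  conjugate (fun s t : R^o => s * t : R) phi.

Section primal_dual.
Context {R : realType} {H : completeNormedModType R}.
Variables (dot : H -> H -> R) (f : H -> \bar R) (z : H).
Variables (K : set nat) (e : nat -> H) (phi : nat -> R^o -> \bar R).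

Definition primal_obj (x : H) : \bar R :=
  (f x + \sum_(k <oo | k \in K) phi k (dot x (e k))
   + (2^-1 * `|x - z| ^+ 2)%R%:E)%E.

Definition dual_obj (nu : l2 R K) : \bar R :=
  (moreau (conjugate dot f) (z - vsum K (fun k => nu k *: e k))%R
   + \sum_(k <oo | k \in K) conjugateR (phi k) (nu k))%E.

(* The subset of l^2(K) whose strong relative interior must contain 0. *)
Definition qualification_set : set (l2 R K) :=
  [set w | exists (x : H) (xi : l2 R K),
     [/\ dom f x,
         (\sum_(k <oo | k \in K) phi k (xi k) < +oo)%E &
         forall k, K k -> w k = dot x (e k) - xi k]].

End primal_dual.

(* Main.v *)
(* A pair (x, v) with z - L* v - x in the subdifferential of f at x and v_k in
   the subdifferential of phi_k at <x, e_k> yields solutions of both problems,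
   where L x = (<x, e_k>)_k. Such a pair is obtained by Tikhonov regularization:
   the dual objective plus (r / 2) |v|^2 has a minimizer v_r, the fixed point of
   a contraction, and <v_r, w> is bounded below uniformly in r for each w in the
   qualification set. As the cone of this set is its closed span, which contains
   v_r, the family (v_r) is bounded by the uniform boundedness principle,
     and its
   weak cluster points as r -> 0 are dual solutions. The algorithm is the
   forward-backward iteration for the dual problem: it is quasi-Fejer monotone
   with respect to the dual solutions and the decrease of the distance controls
   |prox_f (z - L* v_n) - x|^2, which gives the strong convergence of x_n; the
   weak convergence of v_n follows from Opial's lemma. *)
Require Import Defs.
From HB Require Import structures.
From mathcomp Require Import all_boot all_order all_algebra.
From mathcomp Require Import sesquilinear ring lra.
From mathcomp Require Import all_classical all_reals all_analysis.

Set Implicit Arguments.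
Unset Strict Implicit.
Unset Printing Implicit Defensive.

Import Order.TTheory GRing.Theory Num.Theory.
Import numFieldNormedType.Exports.

Local Open Scope classical_set_scope.
Local Open Scope ring_scope.

(** * Subdifferentials and proximal points *)

(** The shaping obstacle: bounds on dual vectors yield weak limits only, and the graph of a
    subdifferential is closed when one component converges in norm and the other weakly. Both
    passages to the limit (r -> 0, then n -> oo) therefore need norm convergence of the primal
    points. It comes from the strong convexity of |x - z|^2 / 2: in the inclusion z - L* v - x, the
    term - x turns monotonicity into a bound of |x - x'|^2 by a pairing of dual vectors. The
    qualification condition serves to bound v_r. Subgradient inequalities bound <v_r, w> from below
    only, but the cone of the set is a linear space, so - w is covered whenever w is; and v_r lies
    in the span because r v_r = L x_r - (L x_r - r v_r) is itself in the set. Conjugates are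
    computed exactly only where a subgradient is at hand, by equality in the Fenchel-Young
    inequality; elsewhere a lower bound suffices. *)

Section inner_product.
Context {R : realType} {V : normedModType R}.
Implicit Types (u v w : V) (phi : V -> \bar R).

(** Instantiated by the given product on H, by [l2dot], and by multiplication on [R^o], so that one
    theory of subdifferentials serves [f] and every [phi k]. *)
Record inner_product (ip : V -> V -> R) : Prop := InnerProduct {
  ipC : forall u v, ip u v = ip v u;
  ipDl : forall u v w, ip (u + v) w = ip u w + ip v w;
  ipZl : forall a v w, ip (a *: v) w = a * ip v w;
  ip_sqr : forall v, ip v v = `|v| ^+ 2 }.

Variables (ip : V -> V -> R) (ipP : inner_product ip).

Lemma ipDr u v w : ip u (v + w) = ip u v + ip u w.
Proof. by rewrite (ipC ipP) (ipDl ipP) !(ipC ipP u). Qed.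

Lemma ipZr a u v : ip u (a *: v) = a * ip u v.
Proof. by rewrite (ipC ipP) (ipZl ipP) (ipC ipP u). Qed.

Lemma ipNl u v : ip (- u) v = - ip u v.
Proof. by rewrite -scaleN1r (ipZl ipP) mulN1r. Qed.

Lemma ipNr u v : ip u (- v) = - ip u v.
Proof. by rewrite (ipC ipP) ipNl (ipC ipP u). Qed.

Lemma ip0l u : ip 0 u = 0.
Proof. by rewrite -(scale0r 0) (ipZl ipP) mul0r. Qed.

Lemma ip0r u : ip u 0 = 0.
Proof. by rewrite (ipC ipP) ip0l. Qed.

Lemma ipBl u v w : ip (u - v) w = ip u w - ip v w.
Proof. by rewrite (ipDl ipP) ipNl. Qed.

Lemma ipBr u v w : ip u (v - w) = ip u v - ip u w.
Proof. by rewrite ipDr ipNr. Qed.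

Definition ipE := ((ipDl ipP), ipDr, (ipZl ipP), ipZr, ipNl, ipNr, ip0l, ip0r).

Lemma sqr_normD u v : `|u + v| ^+ 2 = `|u| ^+ 2 + 2 * ip u v + `|v| ^+ 2.
Proof. by rewrite -!(ip_sqr ipP) !ipE (ipC ipP v u); ring. Qed.

Lemma sqr_normB u v : `|u - v| ^+ 2 = `|u| ^+ 2 - 2 * ip u v + `|v| ^+ 2.
Proof. by rewrite -!(ip_sqr ipP) !ipE (ipC ipP v u); ring. Qed.

Lemma sqr_normZ a u : `|a *: u| ^+ 2 = a ^+ 2 * `|u| ^+ 2.
Proof. by rewrite -!(ip_sqr ipP) !ipE; ring. Qed.

Lemma ip_young u v : 2 * ip u v <= `|u| ^+ 2 + `|v| ^+ 2.
Proof. by have := sqr_ge0 `|u - v|; rewrite sqr_normB => h; lra. Qed.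

Lemma ip_norm u v : `|ip u v| <= `|u| * `|v|.
Proof.
have H (a b : V) : ip a b <= `|a| * `|b|.
  have [->|a0] := eqVneq a 0; first by rewrite ip0l normr0 mul0r.
  have [->|b0] := eqVneq b 0; first by rewrite ip0r normr0 mulr0.
  have na : 0 < `|a| by rewrite normr_gt0.
  have nb : 0 < `|b| by rewrite normr_gt0.
  have := ip_young (`|a|^-1 *: a) (`|b|^-1 *: b).
  rewrite !sqr_normZ !ipE !exprVn !mulVf ?expf_neq0 ?gt_eqF// => h.
  rewrite -(@ler_pM2l _ (`|a|^-1 * `|b|^-1)) ?mulr_gt0 ?invr_gt0//.
  rewrite mulrACA !mulVf ?gt_eqF//; lra.
rewrite ler_norml H andbT lerNl -ipNl; apply: (le_trans (H _ _)).
by rewrite normrN.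
Qed.

Lemma cvg_ip (I : Type) (F : set_system I) {FF : Filter F} (a b : I -> V) u v :
  a @ F --> u -> b @ F --> v -> (fun i => ip (a i) (b i)) @ F --> ip u v.
Proof.
have E x y : ip x y = 2^-1 * (`|x + y| ^+ 2 - `|x| ^+ 2 - `|y| ^+ 2).
  by rewrite sqr_normD; field.
move=> au bv; rewrite E; under eq_fun do rewrite E.
apply: cvgMr; apply: cvgB; first apply: cvgB.
- by apply: cvgM; apply: cvg_norm; exact: cvgD.
- by apply: cvgM; exact: cvg_norm.
- by apply: cvgM; exact: cvg_norm.
Qed.

Definition subdiff phi u v : Prop :=
  phi u \is a fin_num /\ forall w, (phi u + (ip v (w - u))%:E <= phi w)%E.

Lemma subdiff_mono phi u v u' v' :
  subdiff phi u v -> subdiff phi u' v' -> 0 <= ip (v - v') (u - u').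
Proof.
move=> [fu hu] [fu' hu']; have := hu u'; have := hu' u.
rewrite -(fineK fu) -(fineK fu') -!EFinD !lee_fin !ipE => h h'; lra.
Qed.

(** The assumption bears on the pairings with [w - a i] instead of on [b]: bounded weak convergence
    of the dual vectors then suffices once [a] converges in norm. *)
Lemma subdiff_closed phi (I : Type) (F : set_system I) {FF : ProperFilter F}
    (a b : I -> V) u v :
  (forall w, phi w != -oo%E) -> dom phi !=set0 -> lower_semicontinuous phi ->
  (forall i, subdiff phi (a i) (b i)) -> a @ F --> u ->
  (forall w, ip (b i) (w - a i) @[i --> F] --> ip v (w - u)) ->
  subdiff phi u v.
Proof.
move=> phiN [w0 w0d] lsc sub au bv.
have H w : (phi u + (ip v (w - u))%:E <= phi w)%E.
  case pw : (phi w) => [r||]; [|by rewrite leey|by have := phiN w; rewrite pw].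
  rewrite leNgt; apply/negP => lt.
  have {lt} : ((r - ip v (w - u))%:E < phi u)%E.
    by move: lt; rewrite EFinB lteBlDr.
  case pu : (phi u) => [s||//].
    rewrite lte_fin => lt.
    (* The midpoint [m] separates [phi u] from the smaller value that the limit inequality excludes;
       lower semicontinuity keeps [phi (a i)] above it. *)
    pose m := 2^-1 * (s + (r - ip v (w - u))).
    have [|W Wu Wm] := lsc u m; first by rewrite pu lte_fin /m; lra.
    near F => i.
    have [fi /(_ w)] := sub i.
    have : (m%:E < phi (a i))%E by apply: Wm; near: i; exact: au.
    rewrite pw -(fineK fi) -EFinD lte_fin lee_fin.
    suff : r - m < ip (b i) (w - a i) by clear pw pu fi => *; lra.
    near: i; apply: (cvgr_gt (ip v (w - u))); first exact: bv.
    by rewrite /m; lra.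
  move=> _; have [|W Wu Wm] := lsc u (r - ip v (w - u) + 1); first
    by rewrite pu ltry.
  near F => i.
  have [fi /(_ w)] := sub i.
  have : ((r - ip v (w - u) + 1)%:E < phi (a i))%E.
    by apply: Wm; near: i; exact: au.
  rewrite pw -(fineK fi) -EFinD lte_fin lee_fin.
  suff : ip v (w - u) - 1 < ip (b i) (w - a i) by clear pw pu fi => *; lra.
  near: i; apply: (cvgr_gt (ip v (w - u))); first exact: bv.
  by lra.
split=> //; have := H w0; move: w0d (phiN u); rewrite /dom/=.
by case: (phi w0) => [?| |]; case: (phi u).
Unshelve. all: by end_near. Qed.

(** The quadratic gap in [key] gives minimality and uniqueness together, which is what the [xget] in
    [prox] requires. *)
Lemma prox_subdiff phi u p : subdiff phi p (u - p) -> prox phi u = p.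
Proof.
move=> [fp hp]; have key y :
    (prox_obj phi u p + (2^-1 * `|y - p| ^+ 2)%:E <= prox_obj phi u y)%E.
  rewrite /prox_obj; apply: (le_trans _ (leeD (hp y) (le_refl _))).
  rewrite -addeA -EFinD -addeA -EFinD leeD2l// lee_fin le_eqVlt.
  apply/orP; left; apply/eqP.
  have -> : u - y = (u - p) - (y - p) by rewrite opprB addrA subrK.
  by rewrite (sqr_normB (u - p)); field.
have fpo : prox_obj phi u p \is a fin_num by rewrite /prox_obj fin_numD fp.
rewrite /prox; case: xgetP => [q _ | /(_ p)].
  move=> /seteqP[_ /(_ q erefl)] mq.
  have := le_trans (key q) (mq p); rewrite -{2}[prox_obj phi u p]adde0.
  rewrite leeD2lE// lee_fin => h.
  apply/eqP; rewrite -subr_eq0 -normr_eq0 -sqrf_eq0 eq_le sqr_ge0 andbT.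
  by lra.
case; apply/seteqP; split=> [q mq|_ -> y] /=.
  have := le_trans (key q) (mq p); rewrite -{2}[prox_obj phi u p]adde0.
  rewrite leeD2lE// lee_fin => h.
  apply/eqP; rewrite -subr_eq0 -normr_eq0 -sqrf_eq0 eq_le sqr_ge0 andbT.
  by lra.
by apply: le_trans (key y); rewrite leeDl// lee_fin mulr_ge0 ?sqr_ge0.
Qed.

End inner_product.

(** Yields first-order conditions: minimality along a segment, divided by [t], has this form, with
    [B] the quadratic remainder. If [A] were negative, t = 1/2 would force B > 0, and half the root
    - A / (B - A) would violate the assumption. *)
Lemma ge0_of_linear_perturbation {R : realType} (A B : R) :
  (forall t, 0 < t < 1 -> 0 <= A + t * B) -> 0 <= A.
Proof.
move=> h; rewrite leNgt; apply/negP => A0.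
have B0 : 0 < B.
  by have := h 2^-1; rewrite invr_gt0 invf_lt1 ?ltr1n// ltr0n => /(_ isT); lra.
have t0 : 0 < - A / (B - A) < 1.
  by rewrite divr_gt0 ?ltr_pdivrMr ?mul1r /=; lra.
have t1 : 0 < - A / (B - A) / 2 < 1 by move: t0 => /andP[? ?]; apply/andP;
  split; lra.
have := h _ t1.
have -> : A + - A / (B - A) / 2 * B = A * (B / 2 - A) / (B - A) by field; lra.
by apply/negP; rewrite -ltNge pmulr_llt0 ?invr_gt0 ?pmulr_llt0//; lra.
Qed.

(** Serves twice: for minimizing sequences with errors 1 / (n + 1), and for the primal points of the
    regularized problems with r = 1 / (n + 1). *)
Lemma cvgn_sqr_harmonic {R : realType} {V : completeNormedModType R}
    (a : nat -> V) (C : R) :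
  (forall n m, `|a n - a m| ^+ 2 <= C * (n.+1%:R^-1 + m.+1%:R^-1)) -> cvgn a.
Proof.
move=> h; apply/cauchy_cvgP/cauchy_exP => e e0.
have e2 : 0 < e ^+ 2 by rewrite exprn_gt0.
have C1 : 0 < 2 * (`|C| + 1) by rewrite mulr_gt0// ltr_pwDr.
have [N _ HN] : \forall n \near \oo, n.+1%:R^-1 < e ^+ 2 / (2 * (`|C| + 1)).
  exact: (near_infty_natSinv_lt (PosNum (divr_gt0 e2 C1))).
exists (a N); exists N => // n /= Nn; rewrite -ball_normE /=.
rewrite -(@ltr_pXn2r _ 2) ?nnegrE ?normr_ge0 ?(ltW e0)//.
apply: (le_lt_trans (h N n)).
have := HN _ (leqnn N); have := HN _ Nn; rewrite !ltr_pdivlMr//.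
have : 0 <= `|C| - C by rewrite subr_ge0 ler_norm.
have : 0 < (N.+1%:R : R)^-1 by rewrite invr_gt0.
have : 0 < (n.+1%:R : R)^-1 by rewrite invr_gt0.
set x := _^-1; set y := _^-1 => x0 y0 c0; nra.
Qed.

(** * Existence of proximal points by the direct method *)

Section prox_existence.
Context {R : realType} {V : completeNormedModType R}.
Variables (ip : V -> V -> R) (ipP : inner_product ip).
Variable phi : V -> \bar R.
Hypothesis phiG : Gamma0 phi.

Let phi_fin (w : V) : dom phi w -> phi w \is a fin_num.
Proof.
by move: phiG => [/(_ w) + _ _ _]; rewrite /dom/= fin_numE => -> /lt_eqF ->.
Qed.

Let convex_fine (v w : V) (t : R) : dom phi v -> dom phi w -> 0 < t < 1 ->
  dom phi (t *: v + (1 - t) *: w) /\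
  fine (phi (t *: v + (1 - t) *: w))
    <= t * fine (phi v) + (1 - t) * fine (phi w).
Proof.
move=> dv dw t01; have [_ _ _ /(_ v w t t01)] := phiG.
rewrite -(fineK (phi_fin dv)) -(fineK (phi_fin dw)) -!EFinM -EFinD => h.
have d : dom phi (t *: v + (1 - t) *: w) by exact: le_lt_trans h (ltry _).
by split=> //; rewrite -lee_fin (fineK (phi_fin d)).
Qed.

(* Lower semicontinuity bounds [phi] from below on a ball around a point of its
   domain, and convexity propagates this bound along rays. *)
Lemma Gamma0_norm_minorant :
  exists a b : R, 0 <= b /\ forall w, ((a - b * `|w|)%:E <= phi w)%E.
Proof.
have [phiN [u ud] lsc _] := phiG.
have [|W /nbhs_ballP[r /= r0 rW] Wm] := lsc u (fine (phi u) - 1).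
  by rewrite -[ltRHS]fineK ?phi_fin// lte_fin ltrBlDr ltrDl.
exists (fine (phi u) - 1 - 2 / r * `|u|), (2 / r); split.
  by rewrite divr_ge0// ltW.
move=> w; have [dw|] := pselect (dom phi w); last first.
  by rewrite /dom/= => /negP; rewrite -leNgt leye_eq => /eqP ->; rewrite leey.
rewrite -(fineK (phi_fin dw)) lee_fin.
have r2 : 0 < 2 / r by rewrite divr_gt0.
have nwu : `|w - u| <= `|w| + `|u| by exact: ler_normB.
suff : fine (phi u) - 1 - 2 / r * `|w - u| <= fine (phi w).
  by apply: le_trans; nra.
have [lt|le] := ltP `|w - u| r.
  have /Wm : W w by apply: rW; rewrite -ball_normE/= distrC.
  rewrite -(fineK (phi_fin dw)) lte_fin => h.
  have := normr_ge0 (w - u); nra.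
have d0 : 0 < `|w - u| by exact: lt_le_trans le.
(* This [t] puts the convex combination at distance r / 2 from [u], inside the ball where the bound
   holds; dividing the convexity inequality by [t] produces the slope 2 / r. *)
pose t := r / 2 / `|w - u|.
have t0 : 0 < t by rewrite !divr_gt0.
have t1 : t < 1 by rewrite ltr_pdivrMr// mul1r; lra.
have t01 : 0 < t < 1 by rewrite t0.
have [dc cv] := convex_fine dw ud t01.
have /Wm : W (t *: w + (1 - t) *: u).
  apply: rW; rewrite -ball_normE/= distrC.
  have -> : t *: w + (1 - t) *: u - u = t *: (w - u).
    by rewrite scalerBl scale1r scalerBr addrC addrCA addKr.
  rewrite normrZ gtr0_norm// /t divfK ?gt_eqF//; lra.
rewrite -(fineK (phi_fin dc)) lte_fin => h.
have -> : 2 / r * `|w - u| = t^-1.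
  by rewrite /t; field; rewrite !gt_eqF.
rewrite -(ler_pM2l t0) mulrBr divff ?gt_eqF//; nra.
Qed.

(** The point [p] minimizes phi + c / 2 |u - .|^2. The case c = 1 gives [prox phi]; a general [c] is
    what Moreau's decomposition with parameter [g] uses. *)
Lemma subdiff_exists (u : V) (c : R) : 0 < c ->
  exists p, subdiff ip phi p (c *: (u - p)).
Proof.
move=> c0; have [phiN [u0 u0d] lsc _] := phiG.
pose J w := fine (phi w) + c / 2 * `|u - w| ^+ 2.
pose S := [set J w | w in dom phi].
have [a [b [b0 lb]]] := Gamma0_norm_minorant.
have infS : has_inf S.
  split; first by exists (J u0), u0.
  (* Replace |w| by |u| + |u - w| in the minorant and complete the square in |u - w|. *)
  exists (a - b * `|u| - b ^+ 2 / (2 * c)) => _ [w dw <-]; rewrite /J.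
  have := lb w; rewrite -(fineK (phi_fin dw)) lee_fin.
  have : `|w| <= `|u| + `|u - w| by rewrite -[in leLHS](subKr u w) ler_normB.
  have : 0 <= (c * `|u - w| - b) ^+ 2 / (2 * c).
    by rewrite divr_ge0 ?sqr_ge0 ?mulr_ge0 ?ltW.
  have -> : (c * `|u - w| - b) ^+ 2 / (2 * c) =
      c / 2 * `|u - w| ^+ 2 - b * `|u - w| + b ^+ 2 / (2 * c).
    by field; rewrite gt_eqF.
  by nra.
pose m := inf S.
have mJ w : dom phi w -> m <= J w.
  by move=> dw; apply: ge_inf; [exact: infS.2|exists w].
have /choice[y Hy] : forall n : nat, exists w,
    dom phi w /\ J w < m + n.+1%:R^-1.
  move=> n; have n0 : 0 < (n.+1%:R : R)^-1 by rewrite invr_gt0.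
  by have [_ [w dw <-] lt] := inf_adherent n0 infS; exists w.
have half : 0 < (2^-1 : R) < 1 by rewrite invr_gt0 invf_lt1 ?ltr1n ?ltr0n.
(* The parallelogram law at the midpoint: near-minimizers are close to each other, hence minimizing
   sequences are Cauchy. *)
have mid v w : dom phi v -> dom phi w ->
    c / 4 * `|v - w| ^+ 2 <= J v + J w - 2 * m.
  move=> dv dw; have [dc cv] := convex_fine dv dw half.
  have := mJ _ dc; rewrite /J.
  have -> : u - (2^-1 *: v + (1 - 2^-1) *: w) =
      2^-1 *: ((u - v) + (u - w)).
    have -> : 1 - 2^-1 = 2^-1 :> R by field.
    rewrite addrACA -opprD -scalerDr scalerBr; congr (_ - _).
    by rewrite -mulr2n -(scaler_nat 2 u) scalerA mulVf ?scale1r.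
  rewrite (sqr_normZ ipP) (sqr_normD ipP).
  have -> : v - w = (u - w) - (u - v) by rewrite opprB [RHS]addrC addrA subrK.
  rewrite (sqr_normB ipP (u - w)) (ipC ipP (u - w)).
  rewrite (_ : 2^-1 ^+ 2 = 4^-1 :> R); last by field.
  move=> h; move: (fine _) (fine _) (fine _) (ip _ _) (`|u - v| : R)
    (`|u - w| : R) cv h.
  move=> A B C D E F h1 h2.
  by lra.
have /cvg_ex[p yp] : cvgn y.
  apply: (@cvgn_sqr_harmonic _ _ _ (4 / c)) => n k.
  rewrite -(@ler_pM2l _ (c / 4)) ?divr_gt0// [leRHS]mulrA.
  rewrite (_ : c / 4 * (4 / c) = 1); last by field; rewrite gt_eqF.
  have [dn ln] := Hy n; have [dk lk] := Hy k.
  apply: (le_trans (mid _ _ dn dk)); rewrite mul1r.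
  by move: (J _) (J _) (_^-1) (_^-1) ln lk => x1 x2 r1 r2 ln lk; lra.
have phip : (phi p <= (m - c / 2 * `|u - p| ^+ 2)%:E)%E.
  apply/lee_addgt0Pr => e e0; rewrite -EFinD leNgt; apply/negP => lt.
  have [W Wp Wm] := lsc _ _ lt; have e2 : 0 < e / 2 by rewrite divr_gt0.
  near \oo => n.
  have : ((m - c / 2 * `|u - p| ^+ 2 + e)%:E < phi (y n))%E.
    by apply: Wm; near: n; exact: yp.
  have [dn ln] := Hy n; rewrite -(fineK (phi_fin dn)) lte_fin => h.
  have : n.+1%:R^-1 < e / 2.
    by near: n; exact: (near_infty_natSinv_lt (PosNum e2)).
  have : c / 2 * `|u - p| ^+ 2 - e / 2 < c / 2 * `|u - y n| ^+ 2.
    near: n; apply: (cvgr_gt (c / 2 * `|u - p| ^+ 2)); last by lra.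
    apply: cvgMr; apply: cvgM; apply: cvg_norm; apply: cvgB => //;
      exact: cvg_cst.
  move: ln; rewrite /J.
  move: (fine _) (n.+1%:R^-1) h => x1 x2 h h1 h2 h3.
  by lra.
have dp : dom phi p by exact: le_lt_trans phip (ltry _).
have Jp : J p <= m.
  by move: phip; rewrite -(fineK (phi_fin dp)) lee_fin /J; lra.
exists p; split; first exact: phi_fin.
move=> w; have [dw|] := pselect (dom phi w); last first.
  by rewrite /dom/= => /negP; rewrite -leNgt leye_eq => /eqP ->; rewrite leey.
rewrite -(fineK (phi_fin dw)) -(fineK (phi_fin dp)) -EFinD lee_fin -subr_ge0.
apply: (@ge0_of_linear_perturbation _ _ (c / 2 * `|w - p| ^+ 2)) => t t01.
have [dc cv] := convex_fine dw dp t01; have := le_trans Jp (mJ _ dc).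
rewrite /J.
have -> : u - (t *: w + (1 - t) *: p) = (u - p) - t *: (w - p).
  by rewrite scalerBl scale1r scalerBr addrCA opprD addrA.
rewrite (sqr_normB ipP (u - p)) (sqr_normZ ipP) (ipZr ipP) (ipZl ipP).
case/andP: t01 => t0 t1 h; rewrite -(@pmulr_rge0 _ t)//.
move: (fine _) (fine _) (fine _) (ip _ _) (`|u - p| : R) (`|w - p| : R) cv h.
by move=> A B C D E F h1 h2; nra.
Unshelve. all: by end_near. Qed.

Lemma subdiff_prox (u : V) : subdiff ip phi (prox phi u) (u - prox phi u).
Proof.
have [p] := subdiff_exists u ltr01.
by rewrite scale1r => sp; rewrite (prox_subdiff ipP sp).
Qed.

End prox_existence.

(** * Weak topology of l2 *)

(** Ultrafilters take the place of subsequences: one ultrafilter makes all coordinates converge at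
    once, without a diagonal argument. *)
Lemma ultra_bounded_cvg {R : realType} (I : Type) (U : set_system I)
    {UU : UltraFilter U} (g : I -> R) (M : R) :
  (forall i, `|g i| <= M) -> exists l : R, g @ U --> l.
Proof.
move=> gM; have gU : UltraFilter (g @ U).
  split=> [|G GG UG]; first exact: fmap_proper_filter.
  apply/seteqP; split=> // A GA.
  have [//|h] := in_ultra_setVsetC (g @^-1` A) UU.
  have GnA : G (~` A) by exact: UG.
  by have [x []] := filter_ex (filterI GA GnA).
have := @segment_compact _ (- M) M.
rewrite compact_ultra => /(_ _ gU) [|l [_ gl]]; last by exists l.
change (U (g @^-1` `[- M, M]%classic)); apply: filterE => i /=.
by rewrite in_itv/= -ler_norml.
Qed.

Lemma cvgn_series_sqr {R : realType} (c : nat -> R) (M : R) :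
  (forall N, \sum_(0 <= k < N) c k ^+ 2 <= M) ->
  cvgn (series (fun k => c k ^+ 2)).
Proof.
move=> cM; apply: nondecreasing_is_cvgn.
  by apply: nondecreasing_series => i _ _; rewrite sqr_ge0.
by exists M => _ [n _ <-]; exact: cM.
Qed.

Section l2_theory.
Context {R : realType} {K : set nat}.
Implicit Types u v w y : l2 R K.

Lemma l2dot_ip : inner_product (@l2dot R K).
Proof.
split; [exact: l2dotC|exact: l2dotDl|exact: l2dotZl|exact: l2_norm_dot].
Qed.

Lemma l2_out v k : ~ K k -> v k = 0.
Proof. by case: v => v /= /l2_predP[v0 _]; exact: v0. Qed.

Lemma l2P v w : (forall k, K k -> v k = w k) -> v = w.
Proof.
move=> vw; apply/val_inj/funext => k /=; have [/vw//|nKk] := pselect (K k).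
by rewrite !l2_out.
Qed.

Lemma l2_addE v w k : (v + w) k = v k + w k. Proof. by []. Qed.
Lemma l2_oppE v k : (- v) k = - v k. Proof. by []. Qed.
Lemma l2_scaleE a v k : (a *: v) k = a * v k. Proof. by []. Qed.

Lemma l2_coord_le v k : `|v k| <= `|v|.
Proof.
rewrite -(@ler_pXn2r _ 2) ?nnegrE// real_normK ?num_real// -l2_norm_dot.
exact: le_l2dot.
Qed.

Lemma l2_partial_sum v N : \sum_(0 <= k < N) v k ^+ 2 <= `|v| ^+ 2.
Proof.
rewrite -l2_norm_dot /l2dot.
have nd : nondecreasing_seq (series (fun k => v k * v k)).
  by apply: nondecreasing_series => i _ _; rewrite -expr2 sqr_ge0.
exact: (nondecreasing_cvgn_le nd (@is_cvg_l2dot _ _ v v) N).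
Qed.

Lemma l2_mk (c : nat -> R) (M : R) : (forall k, ~ K k -> c k = 0) ->
  (forall N, \sum_(0 <= k < N) c k ^+ 2 <= M) ->
  exists v : l2 R K, l2val v = c /\ `|v| ^+ 2 <= M.
Proof.
move=> c0 cM; have cP : c \in l2_pred R K.
  by apply/l2_predP; split=> //; exact: cvgn_series_sqr cM.
exists (L2 cP); split=> //; rewrite -l2_norm_dot /l2dot /=.
apply: limr_le; first exact: (@is_cvg_l2dot _ _ (L2 cP) (L2 cP)).
by apply: nearW => n; apply: le_trans (cM n).
Qed.

Lemma sum_trunc (c : nat -> R) (N n : nat) : (N <= n)%N ->
  \sum_(0 <= k < n) (if (k < N)%N then c k else 0) = \sum_(0 <= k < N) c k.
Proof.
move=> Nn; rewrite (big_cat_nat _ Nn)//= addrC big_nat_cond big1 ?add0r.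
  by apply: eq_big_nat => i /andP[_ ->].
by move=> i /andP[/andP[Ni _] _]; rewrite ltnNge Ni.
Qed.

Lemma l2_trunc_exists (N : nat) y : exists t : l2 R K,
  (forall k, t k = if (k < N)%N then y k else 0) /\
  forall v, l2dot v t = \sum_(0 <= k < N) v k * y k.
Proof.
have [||t [tE _]] :=
    @l2_mk (fun k => if (k < N)%N then y k else 0) (`|y| ^+ 2).
- by move=> k nKk; rewrite l2_out// if_same.
- move=> n; apply: le_trans (l2_partial_sum y n).
  by apply: ler_sum => i _; case: ifP => // _; rewrite expr0n sqr_ge0.
exists t; split=> [k|v]; first by rewrite tE.
rewrite /l2dot; apply: lim_near_cst => //.
near=> n; rewrite /series/= -(@sum_trunc (fun k => v k * y k) N n).
  by apply: eq_bigr => i _; rewrite tE; case: ifP => // _; rewrite mulr0.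
by near: n; exact: nbhs_infty_ge.
Unshelve. all: by end_near. Qed.

(** Each finite partial sum of squares passes to the limit and stays below M^2, so the
    coordinatewise limit is again in l2; this also gives weak lower semicontinuity of the norm. *)
Lemma l2_fatou (I : Type) (F : set_system I) {FF : ProperFilter F}
    (a : I -> l2 R K) (c : nat -> R) (M : R) :
  (\forall i \near F, `|a i| <= M) ->
  (forall k, a i k @[i --> F] --> c k) ->
  exists w : l2 R K, l2val w = c /\ `|w| <= M.
Proof.
move=> aM ac.
have M0 : 0 <= M by near F => i; apply: le_trans (normr_ge0 (a i)) _; near: i.
have [||w [wE wM]] := @l2_mk c (M ^+ 2).
- move=> k nKk; apply: (cvg_unique _ (ac k)) => //.
  rewrite (_ : (fun i => a i k) = cst 0); first exact: cvg_cst.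
  by apply/funext => i; exact: l2_out.
- move=> N; have h : \sum_(0 <= k < N) a i k ^+ 2 @[i --> F]
      --> \sum_(0 <= k < N) c k ^+ 2.
    by apply: cvg_big => [|k _]; [exact: add_continuous|exact: cvgM].
  rewrite -(cvg_lim _ h)//; apply: limr_le; first by apply/cvg_ex; eexists;
    exact: h.
  near=> i; apply: le_trans (l2_partial_sum _ _) _.
  rewrite ler_pXn2r ?nnegrE//; near: i; exact: aM.
exists w; split=> //.
by rewrite -(@ler_pXn2r _ 2) ?nnegrE.
Unshelve. all: by end_near. Qed.

Lemma l2_weak_cvg (I : Type) (F : set_system I) {FF : ProperFilter F}
    (a : I -> l2 R K) w (M : R) :
  (\forall i \near F, `|a i| <= M) -> (forall k, a i k @[i --> F] --> w k) ->
  forall y, l2dot (a i) y @[i --> F] --> l2dot w y.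
Proof.
move=> aM aw y; have [w' [w'E wM]] := l2_fatou aM aw.
have {w' w'E} wM : `|w| <= M by rewrite (_ : w = w')//; exact: val_inj.
have M0 : 0 <= M by apply: le_trans wM.
apply/cvgrPdist_le => e e0.
(* Chosen so that (M + M) e' <= e / 2; the summand 1 keeps the denominator positive when M = 0. *)
pose e' := e / 4 / (M + 1).
have e'0 : 0 < e' by rewrite !divr_gt0// ltr_wpDl.
have : cvgn (series (fun k => y k * y k)) by exact: is_cvg_l2dot.
move=> /cvgrPdist_le/(_ (e' ^+ 2)); rewrite exprn_gt0// => /(_ isT)[N _ /(_ _
  (leqnn N))].
rewrite -/(l2dot y y) {1}/series /= => yN.
have [t [tk tE]] := l2_trunc_exists N y.
have tt : l2dot t t = l2dot y t.
  by rewrite !tE; apply: eq_big_nat => k /= kN; rewrite tk kN.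
have yt : `|y - t| <= e'.
  rewrite -(@ler_pXn2r _ 2) ?nnegrE ?(ltW e'0)//; apply: le_trans yN.
  rewrite (sqr_normB l2dot_ip) -!l2_norm_dot tt -tE.
  by apply: le_trans (ler_norm _); lra.
have at_ : l2dot (a i) t @[i --> F] --> l2dot w t.
  rewrite tE; under eq_fun do rewrite tE.
  by apply: cvg_big => [|k _]; [exact: add_continuous|apply: cvgMl; exact: aw].
have e2 : 0 < e / 2 by rewrite divr_gt0.
move/cvgrPdist_le : at_ => /(_ _ e2) at_.
near=> i.
have -> : l2dot w y - l2dot (a i) y =
    l2dot w t - l2dot (a i) t + l2dot (w - a i) (y - t).
  by rewrite (ipBl l2dot_ip) !(ipBr l2dot_ip); lra.
apply: (le_trans (ler_normD _ _)); rewrite [leRHS](_ : e = e / 2 + e / 2);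
  last lra.
apply: lerD; first by near: i.
apply: (le_trans (ip_norm l2dot_ip _ _)).
apply: (@le_trans _ _ ((M + M) * e')).
  apply: ler_pM => //; apply: (le_trans (ler_normB _ _)); apply: lerD => //.
  by near: i.
have : e' * (M + 1) = e / 4 by rewrite /e' divfK// gt_eqF// ltr_wpDl.
by clearbody e'; nra.
Unshelve. all: by end_near. Qed.

Lemma l2_weak_compact (I : Type) (U : set_system I) {UU : UltraFilter U}
    (a : I -> l2 R K) (M : R) : (forall i, `|a i| <= M) ->
  exists w, `|w| <= M /\ (forall y, l2dot (a i) y @[i --> U] --> l2dot w y).
Proof.
move=> aM; have UP : ProperFilter U by exact: ultra_proper.
have /choice[c ac] : forall k, exists l : R, a i k @[i --> U] --> l.
  move=> k; apply: (@ultra_bounded_cvg _ _ _ _ _ M) => i.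
  exact: le_trans (l2_coord_le _ _) (aM i).
have aM' : \forall i \near U, `|a i| <= M by exact: filterE.
have [w [wE wM]] := l2_fatou aM' ac; exists w; split=> //.
by apply: (l2_weak_cvg aM') => k; rewrite wE.
Qed.

Lemma l2_weak_coord (I : Type) (F : set_system I) {FF : ProperFilter F}
    (a : I -> l2 R K) w k :
  (forall y, l2dot (a i) y @[i --> F] --> l2dot w y) ->
  a i k @[i --> F] --> w k.
Proof.
move=> aw; have [Kk|nKk] := pselect (K k); last first.
  rewrite l2_out// (_ : (fun i => a i k) = cst 0); first exact: cvg_cst.
  by apply/funext => i; exact: l2_out.
have [||d [dE _]] := @l2_mk (fun j => (j == k)%:R) 1.
- by move=> j nKj; case: eqP => // jk; rewrite jk in nKj.
- move=> N; have [kN|Nk] := ltnP k N.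
    rewrite big_mkord (bigD1 (Ordinal kN))//= eqxx big1 ?expr1n ?addr0//.
    by move=> i; rewrite -val_eqE/= => /negbTE ->; rewrite expr0n.
  rewrite big_nat_cond big1// => i /andP[/andP[_ iN] _].
  by rewrite (_ : (i == k) = false) ?expr0n//; apply/ltn_eqF/(leq_trans iN).
have dk v : l2dot v d = v k.
  rewrite /l2dot; apply: lim_near_cst => //; near=> n.
  have kn : (k < n)%N by near: n; exact: nbhs_infty_gt.
  rewrite /series/= big_mkord (bigD1
    (Ordinal kn))//= dE eqxx mulr1 big1 ?addr0//.
  by move=> i; rewrite -val_eqE/= => /negbTE ->; rewrite mulr0.
by have := aw d; rewrite dk; under eq_fun do rewrite dk.
Unshelve. all: by end_near. Qed.

Lemma l2_norm_le_weak (I : Type) (F : set_system I) {FF : ProperFilter F}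
    (a : I -> l2 R K) w (M : R) :
  (\forall i \near F, `|a i| <= M) ->
  (forall y, l2dot (a i) y @[i --> F] --> l2dot w y) -> `|w| <= M.
Proof.
move=> aM aw; have ac k : a i k @[i --> F] --> w k by exact: l2_weak_coord.
have [w' [w'E ?]] := l2_fatou aM ac.
by rewrite (_ : w = w')//; exact: val_inj.
Qed.

(* The limit is a weak cluster point along an ultrafilter, so that completeness
   of l2 is not needed. *)
Lemma l2_geometric_cvg (u : nat -> l2 R K) (C q : R) : 0 <= q < 1 ->
  (forall n, `|u n.+1 - u n| <= C * q ^+ n) ->
  exists w, u @ \oo --> w /\ forall n, `|u n - w| <= C / (1 - q) * q ^+ n.
Proof.
move=> /andP[q0 q1] uC.
have C0 : 0 <= C.
  by have := le_trans (normr_ge0 _) (uC 0%N); rewrite expr0 mulr1.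
have d0 : 0 < 1 - q by rewrite subr_gt0.
(* The factor [1 - q ^+ m] is the exact geometric partial sum, which lets the induction on [m]
   close. *)
have step n m : `|u n - u (n + m)%N| <= C / (1 - q) * q ^+ n * (1 - q ^+ m).
  elim: m => [|m IH]; first by rewrite addn0 subrr normr0 expr0 subrr mulr0.
  rewrite addnS.
  rewrite (_ : u n - _ = (u n - u (n + m)%N) - (u (n + m).+1 - u (n + m)%N)).
    apply: (le_trans (ler_normB _ _)); apply: (le_trans (lerD IH (uC _))).
    rewrite exprD exprS le_eqVlt; apply/orP; left; apply/eqP.
    by field; rewrite gt_eqF.
  by rewrite opprB addrA subrK.
have step' n m : `|u n - u (n + m)%N| <= C / (1 - q) * q ^+ n.
  apply: (le_trans (step n m)); rewrite ler_piMr//.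
    by rewrite !mulr_ge0 ?exprn_ge0// invr_ge0 ltW.
  by rewrite lerBlDr lerDl exprn_ge0.
have [U [UU oU]] := ultraFilterLemma eventually_filter.
have UP : ProperFilter U by exact: ultra_proper.
have [w [_ uw]] : exists w, `|w| <= `|u 0%N| + C / (1 - q) /\
    (forall y, l2dot (u i) y @[i --> U] --> l2dot w y).
  apply: l2_weak_compact => i.
  rewrite -[u i](subKr (u 0%N)); apply: (le_trans (ler_normB _ _)).
  by rewrite lerD2l; have := step' 0%N i; rewrite add0n expr0 mulr1.
have uwn n : `|u n - w| <= C / (1 - q) * q ^+ n; last first.
  exists w; split=> //; apply/cvgrPdist_le => e e0.
  have := @cvg_geometric _ (C / (1 - q)) q.
  rewrite ger0_norm// => /(_ q1)/cvgrPdist_le/(_ _ e0); apply: filterS => n.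
  rewrite /geometric/= sub0r normrN distrC; apply: le_trans.
  exact: le_trans (uwn n) (ler_norm _).
apply: (@l2_norm_le_weak _ U _ (fun i => u n - u i)).
  by apply: oU; exists n => // i /= ni; rewrite -(subnKC ni).
move=> y; rewrite (ipBl l2dot_ip); under eq_fun do rewrite (ipBl l2dot_ip).
by apply: cvgB; [exact: cvg_cst|exact: uw].
Qed.

Lemma l2_contraction (T : l2 R K -> l2 R K) (q : R) : 0 <= q < 1 ->
  (forall u v, `|T u - T v| <= q * `|u - v|) -> exists w, T w = w.
Proof.
move=> q01 Tq; have /andP[q0 q1] := q01; pose u n := iter n T 0.
have [n|w [_ uw]] := @l2_geometric_cvg u `|T 0| q q01.
  elim: n => [|n IH]; first by rewrite /u/= subr0 expr0 mulr1.
  by apply: (le_trans (Tq _ _)); rewrite exprS mulrCA ler_wpM2l.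
exists w; apply/eqP; rewrite -subr_eq0 -normr_le0; apply/ler_addgt0Pr => e e0.
have := @cvg_geometric _ (2 * (`|T 0| / (1 - q))) q.
rewrite ger0_norm// => /(_ q1)/cvgrPdist_le/(_ _ e0)[N _ /(_ _ (leqnn N))].
rewrite /geometric/= sub0r normrN => hN; rewrite add0r; apply: le_trans hN.
apply: le_trans (ler_norm _).
rewrite (_ : T w - w = (u N.+1 - w) - (T (u N) - T w)); last first.
  by rewrite (_ : u N.+1 = T (u N))// opprB [RHS]addrC addrA subrK.
apply: (le_trans (ler_normB _ _)); rewrite -mulrA mulrDl mul1r lerD//.
  apply: (le_trans (uw _)); rewrite exprS mulrCA ler_piMl ?(ltW q1)//.
  by rewrite (le_trans (normr_ge0 _) (uw N)).
apply: (le_trans (Tq _ _)); apply: (le_trans (ler_wpM2l q0 (uw N))).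
by rewrite ler_piMl ?(ltW q1)// (le_trans (normr_ge0 _) (uw N)).
Qed.

(* Sokal's elementary proof: signs [s n] are chosen so that the [n]-th vector
   detects the series with general term [s n * 3^-n * v n / |v n|]. *)
Lemma l2_uniform_boundedness (A : set (l2 R K)) :
  (forall w, closure (lin_span A) w ->
     exists C : R, forall v, A v -> C <= l2dot v w) ->
  exists M : R, forall v, A v -> `|v| <= M.
Proof.
move=> bA; apply: contrapT => nM.
(* The growth 9^n beats the weights 3^-n: the products 3^-n |v n| still exceed 3^n. *)
have /choice[v vP] : forall n, exists v, A v /\ 9 ^+ n < `|v|.
  move=> n; apply: contrapT => nv; apply: nM; exists (9 ^+ n) => v Av.
  by rewrite leNgt; apply/negP => lt; apply: nv; exists v.
have v0 n : 0 < `|v n| by apply: le_lt_trans (vP n).2; rewrite exprn_ge0.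
pose t n : R := (3^-1) ^+ n / `|v n|.
pose sg n (u : l2 R K) : R := if 0 <= l2dot (v n) u then t n else - t n.
pose fix u n : l2 R K := if n is m.+1 then u m + sg m (u m) *: v m else 0.
have t0 n : 0 < t n by rewrite divr_gt0// exprn_gt0// invr_gt0.
have sgt n x : `|sg n x| = t n.
  by rewrite /sg; case: ifP => _; rewrite ?normrN gtr0_norm.
have uC n : `|u n.+1 - u n| <= 1 * 3^-1 ^+ n.
  by rewrite /= addrC addKr normrZ sgt /t divfK ?gt_eqF// mul1r.
have q01 : 0 <= (3^-1 : R) < 1 by lra.
have [w [cw uw]] := l2_geometric_cvg q01 uC.
have spanu n : lin_span A (u n).
  exists n, (fun i : 'I_n => sg i (u i)), (fun i : 'I_n => v i); split.
    by move=> i; have [] := vP i.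
  elim: n => [|n IH]; first by rewrite big_ord0.
  by rewrite big_ord_recr /= IH.
have cl (u' : nat -> l2 R K) w' : (forall n, lin_span A (u' n)) ->
    u' n @[n --> \oo] --> w' -> closure (lin_span A) w'.
  move=> su' cu' B Bw'; have [n Bn] := @filter_ex _ \oo _ (u' @^-1` B)
    (cu' _ Bw').
  by exists (u' n); split.
have [C hC] := bA _ (cl u w spanu cw).
(* The assumption gives lower bounds only; applied to [- w], it supplies the upper bound. *)
have [C' hC'] : exists C, forall v, A v -> C <= l2dot v (- w).
  apply: bA; apply: (cl (fun n => - u n)); last exact: cvgN.
  move=> n; have [m [a [d [Ad ->]]]] := spanu n.
  exists m, (fun i => - a i), d; split=> //.
  by rewrite -sumrN; apply: eq_bigr => i _; rewrite scaleNr.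
(* By the choice of sign, [u n.+1] pairs with [v n] to at least 3^-n |v n|; the tail of the series
   has norm at most 3^-n / 2 and destroys at most half of this. *)
have vw n : 3^-1 ^+ n / 2 * `|v n| <= `|l2dot (v n) w|.
  have h : 3^-1 ^+ n * `|v n| <= `|l2dot (v n) (u n.+1)|.
    have tv : t n * `|v n| ^+ 2 = 3^-1 ^+ n * `|v n|.
      by rewrite /t expr2 mulrA divfK// gt_eqF.
    have p0 : 0 <= 3^-1 ^+ n * `|v n| by rewrite mulr_ge0// exprn_ge0// ltW.
    rewrite /= (ipDr l2dot_ip) (ipZr l2dot_ip) l2_norm_dot /sg.
    case: ifPn => [ge|]; first by rewrite tv ger0_norm ?addr_ge0// lerDr.
    by rewrite -ltNge mulNr tv => lt; rewrite ltr0_norm; lra.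
  have := le_trans (ip_norm l2dot_ip (v n) (u n.+1 - w))
    (ler_wpM2l (normr_ge0 _) (uw n.+1)).
  have := lerB_dist (l2dot (v n) (u n.+1)) (l2dot (v n) w).
  rewrite -(ipBr l2dot_ip) exprS.
  rewrite (_ : 1 / (1 - 3^-1) * (3^-1 * 3^-1 ^+ n) = 3^-1 ^+ n / 2); last
    by field.
  by move: h; lra.
pose B := `|C| + `|C'|.
have vB n : `|l2dot (v n) w| <= B.
  have := hC _ (vP n).1; have := hC' _ (vP n).1; rewrite
    (ipNr l2dot_ip) ler_norml.
  have := ler_norm (- C); have := ler_norm (- C'); rewrite !normrN.
  have := normr_ge0 C; have := normr_ge0 C'; rewrite /B => *.
  by apply/andP; split; lra.
have B2 : 0 <= 2 * B by rewrite mulr_ge0// addr_ge0.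
have := archi_boundP B2; set n := Num.bound _ => nB.
have := le_trans (vw n) (vB n).
have n3 : n%:R <= 3 ^+ n :> R by rewrite -natrX ler_nat ltnW// ltn_expl.
have : 3 ^+ n <= 3^-1 ^+ n * `|v n|.
  rewrite exprVn mulrC ler_pdivlMr ?exprn_gt0// -exprMn ltW//.
  by have := (vP n).2; rewrite (_ : 3 * 3 = 9 :> R)// -natrM.
by move: nB n3; move: (3^-1 ^+ n) (n%:R : R) (3 ^+ n : R) => x1 x2 x3; lra.
Qed.

(* Opial's lemma: two weak cluster points w and w' coincide because
   <v n, w - w'> converges. *)
Lemma l2_opial (v : nat -> l2 R K) (S : set (l2 R K)) (M : R) :
  (forall n, `|v n| <= M) ->
  (forall w, S w -> cvgn (fun n => `|v n - w| ^+ 2)) ->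
  (forall (U : set_system nat) w, UltraFilter U -> \oo `<=` U ->
     (forall y, l2dot (v i) y @[i --> U] --> l2dot w y) -> S w) ->
  exists w, S w /\ weak_cvg l2dot v w.
Proof.
move=> vM fejer clS.
have [U [UU oU]] := ultraFilterLemma eventually_filter.
have [w [_ vw]] := l2_weak_compact vM.
have Sw : S w by exact: clS vw.
exists w; split=> // y; apply/cvgrPdist_lt => e e0; apply: contrapT => nw.
(* Failure of convergence makes [B] infinite; an ultrafilter concentrated on [B] yields a cluster
   point [w'] that cannot equal [w]. *)
pose B := [set n | e <= `|l2dot w y - l2dot (v n) y|].
have wP : ProperFilter (within B \oo).
  split; last exact: within_filter.
  move=> h; have {}h : \forall n \near \oo, B n -> False by exact: h.
  apply: nw; apply: filterS h => n nB.
  by rewrite ltNge; apply/negP => /nB.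
have [U' [UU' wU']] := ultraFilterLemma wP.
have oU' : \oo `<=` U'.
  by move=> D oD; apply: wU'; apply: filterS oD => n Dn _.
have [w' [_ vw']] := l2_weak_compact vM.
have Sw' : S w' by exact: clS vw'.
have : cvgn (fun n => l2dot (v n) (w - w')).
  rewrite (_ : (fun n => _) = (fun n => 2^-1 * (`|v n - w'| ^+ 2
      - `|v n - w| ^+ 2 - (`|w'| ^+ 2 - `|w| ^+ 2)))).
    apply: is_cvgMr; apply: is_cvgB; last exact: is_cvg_cst.
    by apply: is_cvgB; exact: fejer.
  apply/funext => n; rewrite (sqr_normB l2dot_ip (v n) w') (sqr_normB l2dot_ip
    (v n) w).
  rewrite (ipBr l2dot_ip).
  move: (l2dot _ w) (l2dot _ w') (`|v n| ^+ 2) (`|w| ^+ 2) (`|w'| ^+ 2).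
  by move=> *; field.
move=> /cvg_ex[L vL].
have UP : ProperFilter U by exact: ultra_proper.
have UP' : ProperFilter U' by exact: ultra_proper.
have E1 : L = l2dot w (w - w').
  have h : l2dot (v n) (w - w') @[n --> U] --> L by move=> D /vL; exact: oU.
  by rewrite -(cvg_lim _ h)// -(cvg_lim _ (vw (w - w'))).
have E2 : L = l2dot w' (w - w').
  have h : l2dot (v n) (w - w') @[n --> U'] --> L by move=> D /vL; exact: oU'.
  by rewrite -(cvg_lim _ h)// -(cvg_lim _ (vw' (w - w'))).
have ww' : w = w'.
  apply/eqP; rewrite -subr_eq0 -normr_eq0 -sqrf_eq0 -l2_norm_dot.
  by rewrite (ipBl l2dot_ip) -E1 -E2 subrr.
have := vw' y; rewrite -ww' => /cvgrPdist_lt/(_ _ e0) h.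
have UB : U' B by apply: wU'; rewrite /within/=; exact: filterE.
have [n [/= h1]] := filter_ex (filterI h UB).
by rewrite /B/= leNgt h1.
Qed.

Lemma l2_weak_strong_cvg (I : Type) (F : set_system I) {FF : ProperFilter F}
    (a b : I -> l2 R K) u v (M : R) :
  (forall i, `|a i| <= M) ->
  (forall y, l2dot (a i) y @[i --> F] --> l2dot u y) -> b @ F --> v ->
  l2dot (a i) (b i) @[i --> F] --> l2dot u v.
Proof.
move=> aM au bv; rewrite -[l2dot u v]addr0.
rewrite (_ : (fun i => _) = fun i => l2dot (a i) v + l2dot (a i) (b i - v)).
  apply: cvgD; first exact: au.
  apply/norm_cvg0P; apply: (@squeeze_cvgr _ _ _ _ (cst 0) (fun i =>
    M * `|b i - v|)).
  - apply: nearW => i; rewrite /cst normr_ge0/=.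
    by apply: (le_trans (ip_norm l2dot_ip _ _)); rewrite ler_wpM2r.
  - exact: cvg_cst.
  - rewrite -(mulr0 M); apply: cvgMr; rewrite -(@normr0 _ (l2 R K)).
    by apply: cvg_norm; rewrite -(subrr v); apply: cvgB => //; exact: cvg_cst.
by apply/funext => i; rewrite -(ipDr l2dot_ip) subrKC.
Qed.

Lemma l2_cvg_coord (I : Type) (F : set_system I) {FF : Filter F}
    (b : I -> l2 R K) v k : b @ F --> v -> b i k @[i --> F] --> v k.
Proof.
move=> bv; apply/cvgrPdist_le => e e0; move/cvgrPdist_le : bv => /(_ _ e0).
apply: filterS => i; apply: le_trans; exact: (l2_coord_le (v - b i) k).
Qed.

Lemma l2_bounded_cvg0 (I : Type) (F : set_system I) {FF : Filter F}
    (r : I -> R) (a : I -> l2 R K) (M : R) :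
  (forall i, `|a i| <= M) -> r @ F --> 0 -> r i *: a i @[i --> F] --> 0.
Proof.
move=> aM r0; apply/norm_cvg0P.
apply: (@squeeze_cvgr _ _ _ _ (cst 0) (fun i => `|r i| * M)).
- apply: nearW => i; rewrite /cst normr_ge0/= normrZ.
  by rewrite ler_wpM2l.
- exact: cvg_cst.
- rewrite -(mul0r M); apply: cvgMl; rewrite -(@normr0 _ R).
  exact: cvg_norm.
Qed.

(** Needed because the qualification set is only known to contain the small multiples
    [n.+1%:R^-1 *: v n], whereas boundedness is sought for the [v n] themselves. *)
Lemma lin_span_sub_scale (A D : set (l2 R K)) :
  (forall u, A u -> exists c d, D d /\ u = c *: d) ->
  lin_span A `<=` lin_span D.
Proof.
move=> AD w [n [a [u [Au ->]]]].
have /choice[c /choice[d cd]] : forall i : 'I_n, exists c, exists d,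
    D d /\ u i = c *: d by move=> i; exact: AD.
exists n, (fun i => a i * c i), d; split=> [i|]; first exact: (cd i).1.
by apply: eq_bigr => i _; rewrite (cd i).2 scalerA.
Qed.

End l2_theory.

(** * Conjugates and separable sums *)

Section conjugate_theory.
Context {R : realType} {V : normedModType R}.
Variables (ip : V -> V -> R) (ipP : inner_product ip) (phi : V -> \bar R).

Lemma conjugate_ge (p u : V) : phi p \is a fin_num ->
  ((ip p u - fine (phi p))%:E <= conjugate ip phi u)%E.
Proof. by move=> fp; apply: ereal_sup_ubound; exists p; rewrite // EFinB fineK.
  Qed.

Lemma conjugate_subdiff (p u : V) : subdiff ip phi p u ->
  conjugate ip phi u = (ip p u - fine (phi p))%:E.
Proof.
move=> [fp hp]; apply/eqP; rewrite eq_le conjugate_ge// andbT.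
apply: ge_ereal_sup => _ [w _ <-]; have := hp w; rewrite -{1}(fineK fp).
case: (phi w) => [r||]//=; last by rewrite leNye.
rewrite !lee_fin (ipBr ipP) (ipC ipP w) (ipC ipP p) => h; lra.
Qed.

(** Sum of Fenchel-Young at [p] and of Young's inequality for [p] and u - y. Both are equalities at
    y = u - p when u - p is a subgradient at [p], which gives the exact value in
    [moreau_conjugate_subdiff]. *)
Lemma moreau_conjugate_ge (p u : V) : phi p \is a fin_num ->
  ((ip p u - fine (phi p) - 2^-1 * `|p| ^+ 2)%:E
     <= moreau (conjugate ip phi) u)%E.
Proof.
move=> fp; apply: le_ereal_inf_tmp => _ [y _ <-].
apply: le_trans (leeD2r _ (conjugate_ge y fp)); rewrite -EFinD lee_fin.
rewrite [ip p u](_ : _ = ip p y + ip p (u - y)); last first.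
  by rewrite (ipBr ipP) addrC subrK.
by have := ip_young ipP p (u - y); lra.
Qed.

Lemma moreau_conjugate_subdiff (p u : V) : subdiff ip phi p (u - p) ->
  moreau (conjugate ip phi) u = (ip p u - fine (phi p) - 2^-1 * `|p| ^+ 2)%:E.
Proof.
move=> sp; apply/eqP; rewrite eq_le moreau_conjugate_ge ?(proj1 sp)// andbT.
apply: (@le_trans _ _ (prox_obj (conjugate ip phi) u (u - p))).
  by apply: ereal_inf_lbound; exists (u - p).
rewrite /prox_obj.
rewrite (conjugate_subdiff sp) subKr -EFinD (ipBr ipP) (ip_sqr ipP).
by rewrite lee_fin; lra.
Qed.

End conjugate_theory.

Lemma mulr_inner_product {R : realType} :
  inner_product (fun s t : R^o => s * t : R).
Proof.
split=> [s t|s t w|a s w|s]; rewrite ?mulrDl//; first exact: mulrC.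
  by rewrite /GRing.scale/= mulrA.
by rewrite real_normK ?num_real// expr2.
Qed.

Section scalar_prox.
Context {R : realType}.
Variable phi : R^o -> \bar R.
Hypothesis phiG : Gamma0 phi.

Definition rsubdiff (s p : R) : Prop :=
  subdiff (fun s t : R^o => s * t : R) phi s p.

(* Moreau's decomposition: the proximal point of [g * phi^*] is built from a
   proximal point of [phi], so that [phi^*] need not be studied. *)
Lemma rsubdiff_prox_conjugate (g : R) (t : R) : 0 < g ->
  let p := prox (fun t : R^o => (g%:E * conjugateR phi t)%E) t in
  rsubdiff (g^-1 * (t - p)) p.
Proof.
move=> g0 /=; set psi := fun _ => _.
(* Here q is the proximal point of phi / g at t / g, and the decomposition reads p = t - g q. *)
have [q sq] := subdiff_exists mulr_inner_product phiG (g^-1 * t) g0.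
set p := g *: _ in sq.
have pE : p = t - g * q by rewrite /p /GRing.scale/= mulrBr mulVKf ?gt_eqF.
have Cp := conjugate_subdiff mulr_inner_product sq.
have -> : prox psi t = p.
  apply: (prox_subdiff mulr_inner_product); rewrite /psi; split.
    by rewrite /conjugateR Cp.
  move=> w; rewrite /conjugateR Cp.
  have := @conjugate_ge _ _ (fun s t : R^o => s * t : R) _ _ w sq.1.
  rewrite -(@lee_pmul2l _ g%:E) ?lte_fin//; apply: le_trans.
  by rewrite -!EFinM -EFinD lee_fin pE le_eqVlt; apply/orP; left; apply/eqP;
    ring.
have -> : g^-1 * (t - p) = q by rewrite pE subKr mulKf ?gt_eqF.
exact: sq.
Qed.

End scalar_prox.

Section series_lemmas.
Context {R : realType} {K : set nat}.

Lemma eseries_fin (a : nat -> \bar R) (c : nat -> R) :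
  (forall k, K k -> a k = (c k)%:E) -> (forall k, ~ K k -> c k = 0) ->
  cvgn (series c) -> (\sum_(k <oo | k \in K) a k = (limn (series c))%:E)%E.
Proof.
move=> ac c0 cc; rewrite -EFin_lim//; congr (limn _); apply/funext => n /=.
rewrite /series/= -sumEFin big_mkcond/=; apply: eq_bigr => k _.
by case: ifPn => [/set_mem/ac//|/negP kK]; rewrite c0// => /mem_set.
Qed.

Lemma nneseries_ge (a : nat -> \bar R) (c : nat -> R) :
  (forall k, K k -> (0 <= a k)%E) ->
  (forall k, K k -> ((c k)%:E <= a k)%E) -> (forall k, ~ K k -> c k = 0) ->
  cvgn (series c) -> ((limn (series c))%:E <= \sum_(k <oo | k \in K) a k)%E.
Proof.
move=> a0 ac c0 cc; rewrite -EFin_lim//; apply: lee_lim.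
- apply/cvg_ex; exists (limn (series c))%:E.
  by apply: cvg_EFin; [exact: nearW|exact: cc].
- by apply: is_cvg_nneseries => k _ /set_mem; exact: a0.
- apply: nearW => n; rewrite /series/= -sumEFin [leRHS]big_mkcond/=.
  apply: lee_sum => k _; case: ifPn => [/set_mem/ac//|/negP kK].
  by rewrite c0// => /mem_set.
Qed.

Lemma nneseries_partial_sum (c : nat -> R) (M : R) :
  (\sum_(k <oo | k \in K) (`|c k| ^+ 2)%:E <= M%:E)%E ->
  forall N, \sum_(0 <= k < N) (if k \in K then c k else 0) ^+ 2 <= M.
Proof.
move=> h N; rewrite -lee_fin -sumEFin; apply: le_trans h.
apply: le_trans (nneseries_lim_ge N _); last first.
  by move=> k _ _; rewrite lee_fin sqr_ge0.
rewrite [leRHS]big_mkcond/=; apply: lee_sum => k _; case: ifP => _.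
  by rewrite real_normK ?num_real.
by rewrite expr0n.
Qed.

End series_lemmas.

(** * Separable sums on l2 and their proximity operators *)

Section separable.
Context {R : realType} {K : set nat}.
Variable phi : nat -> R^o -> \bar R.
Hypothesis phiG : forall k, K k -> Gamma0 (phi k).
Hypothesis phi_min : forall k, K k ->
  phi k 0 = 0%E /\ forall t, (phi k 0%R <= phi k t)%E.

Definition sep_subdiff (xi v : l2 R K) : Prop :=
  forall k, K k -> rsubdiff (phi k) (xi k) (v k).

Lemma rsubdiff00 k : K k -> rsubdiff (phi k) 0 0.
Proof.
move=> Kk; have [p0 pm] := phi_min Kk; split; first by rewrite p0.
by move=> w; rewrite mul0r adde0.
Qed.

Lemma l2dot_ge0_coord (v w : l2 R K) :
  (forall k, K k -> 0 <= v k * w k) -> 0 <= l2dot v w.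
Proof.
move=> vw; apply: limr_ge; first exact: is_cvg_l2dot.
apply: nearW => n; apply: sumr_ge0 => k _.
by have [/vw//|nKk] := pselect (K k); rewrite l2_out// mul0r.
Qed.

Lemma sep_subdiff_mono (xi v xi' v' : l2 R K) :
  sep_subdiff xi v -> sep_subdiff xi' v' -> 0 <= l2dot (v - v') (xi - xi').
Proof.
move=> s s'; apply: l2dot_ge0_coord => k Kk.
exact: (subdiff_mono mulr_inner_product (s k Kk) (s' k Kk)).
Qed.

(** Summability is derived, not assumed: the subgradient inequality at 0, where [phi k] vanishes,
    gives 0 <= phi_k(xi_k) <= xi_k v_k, and the right-hand side is summable as a product of two l2
    sequences. The coordinatewise relations can then be added up. *)
Lemma sep_sums (xi v : l2 R K) : sep_subdiff xi v -> exists S : R,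
  [/\ (\sum_(k <oo | k \in K) phi k (xi k) = S%:E)%E, 0 <= S,
      forall eta : l2 R K, ((S + l2dot v (eta - xi))%:E
        <= \sum_(k <oo | k \in K) phi k (eta k))%E,
      (\sum_(k <oo | k \in K) conjugateR (phi k) (v k)
        = (l2dot xi v - S)%:E)%E &
      forall u : l2 R K, ((l2dot xi u - S)%:E
        <= \sum_(k <oo | k \in K) conjugateR (phi k) (u k))%E].
Proof.
move=> sub.
pose s k : R := if k \in K then fine (phi k (xi k)) else 0.
have phi0 k t : K k -> (0 <= phi k t)%E.
  by move=> Kk; have [<- ] := phi_min Kk; apply.
have conj0 k t : K k -> (0 <= conjugateR (phi k) t)%E.
  move=> Kk; have [p0 _] := phi_min Kk.
  have := @conjugate_ge _ _ (fun s t : R^o => s * t : R) (phi k) 0 t.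
  by rewrite p0 /= mul0r subr0; apply.
have sE k : K k -> phi k (xi k) = (s k)%:E.
  by move=> Kk; rewrite /s mem_set// fineK//; have [] := sub k Kk.
have s_out k : ~ K k -> s k = 0.
  by move=> nKk; rewrite /s; case: ifPn => // /set_mem.
have s0 k : 0 <= s k.
  rewrite /s; case: ifPn => // /set_mem Kk.
  by rewrite -lee_fin -?sE// /s fineK ?phi0//; have [] := sub k Kk.
have sv k : s k <= xi k * v k.
  have [Kk|nKk] := pselect (K k); last by rewrite s_out// l2_out// mul0r.
  have [_ /(_ 0)] := sub k Kk; have [-> _] := phi_min Kk.
  rewrite sE// -EFinD lee_fin; lra.
have cs : cvgn (series s).
  apply: (series_le_cvg s0 _ sv); first by move=> k; exact: le_trans (s0 k)
    (sv k).
  exact: is_cvg_l2dot.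
have cd (u w : l2 R K) : cvgn (series (fun k => u k * w k)).
  exact: is_cvg_l2dot.
exists (limn (series s)); split.
- exact: eseries_fin.
- by apply: limr_ge => //; apply: nearW => n; exact: sumr_ge0.
- move=> eta; rewrite /l2dot -lim_seriesD//; apply: nneseries_ge => //.
  + by move=> k Kk; exact: phi0.
  + move=> k Kk; have [_ /(_ (eta k))] := sub k Kk.
    by rewrite sE// -EFinD.
  + by move=> k nKk; rewrite !fctE s_out// l2_out// mul0r addr0.
  + exact: is_cvg_seriesD.
- rewrite /l2dot -lim_seriesB//; apply: eseries_fin.
  + move=> k Kk; rewrite /conjugateR.
    by rewrite (conjugate_subdiff mulr_inner_product (sub k Kk)) sE.
  + by move=> k nKk; rewrite !fctE s_out// l2_out// mul0r subr0.
  + exact: is_cvg_seriesB.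
- move=> u; rewrite /l2dot -lim_seriesB//; apply: nneseries_ge.
  + by move=> k Kk; exact: conj0.
  + move=> k Kk; have [fk _] := sub k Kk.
    have := @conjugate_ge _ _ (fun s t : R^o => s * t : R) _ _ (u k) fk.
    by rewrite sE.
  + by move=> k nKk; rewrite !fctE s_out// l2_out// mul0r subr0.
  + exact: is_cvg_seriesB.
Qed.

Definition sprox (g : R) (k : nat) (t : R) : R :=
  prox (fun t : R^o => (g%:E * conjugateR (phi k) t)%E) t.

(** Monotonicity against the pair (0, 0), available because 0 minimizes [phi k]. This bound is why
    the coordinatewise proximal map sends l2 into l2. *)
Lemma sprox_le (g t : R) k : 0 < g -> K k -> `|sprox g k t| <= `|t|.
Proof.
move=> g0 Kk; have sp := rsubdiff_prox_conjugate (phiG Kk) t g0.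
have := subdiff_mono mulr_inner_product sp (rsubdiff00 Kk).
rewrite -/(sprox g k t) !subr0; set p := sprox g k t.
rewrite mulrCA pmulr_rge0 ?invr_gt0// => h.
have [->|p0] := eqVneq p 0; first by rewrite normr0.
rewrite -(@ler_pM2l _ `|p|) ?normr_gt0// -!normrM.
apply: le_trans (ler_norm _); rewrite ger0_norm -?expr2 ?sqr_ge0//; lra.
Qed.

Lemma Tprox_subproof (g : R) (w : l2 R K) : exists v : l2 R K, 0 < g ->
  forall k, K k -> v k = sprox g k (w k).
Proof.
have [g0|] := boolP (0 < g); last by exists 0.
have [||v [vE _]] :=
  @l2_mk R K (fun k => if k \in K then sprox g k (w k) else 0) (`|w| ^+ 2).
- by move=> k nKk; case: ifPn => // /set_mem.
- move=> N; apply: le_trans (l2_partial_sum w N); apply: ler_sum => k _.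
  case: ifPn => [/set_mem Kk|_]; last by rewrite expr0n sqr_ge0.
  rewrite -[leRHS]real_normK ?num_real// -[leLHS]real_normK ?num_real//.
  by rewrite ler_pXn2r ?nnegrE// sprox_le.
by exists v => _ k Kk; rewrite vE mem_set.
Qed.

(** The proximity operator of g times the separable sum of the conjugates. The guard [0 < g] makes
    the set nonempty for every [g], so the default value is never returned. *)
Definition Tprox (g : R) (w : l2 R K) : l2 R K := xget 0
  [set v : l2 R K | 0 < g -> forall k, K k -> v k = sprox g k (w k)].

Lemma TproxE (g : R) (w : l2 R K) k : 0 < g -> K k ->
  Tprox g w k = sprox g k (w k).
Proof.
move=> g0 Kk; rewrite /Tprox; case: xgetP => [v _ /(_ g0 k Kk)//|nv].
by have [v vP] := Tprox_subproof g w; case: (nv v).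
Qed.

Lemma Tprox_subdiff (g : R) (w : l2 R K) : 0 < g ->
  sep_subdiff (g^-1 *: (w - Tprox g w)) (Tprox g w).
Proof.
move=> g0 k Kk; rewrite l2_scaleE l2_addE l2_oppE TproxE//.
exact: (rsubdiff_prox_conjugate (phiG Kk)).
Qed.

Lemma Tprox_firm (g : R) (u w : l2 R K) : 0 < g ->
  `|Tprox g u - Tprox g w| ^+ 2
    + `|(u - Tprox g u) - (w - Tprox g w)| ^+ 2 <= `|u - w| ^+ 2.
Proof.
move=> g0.
have := sep_subdiff_mono (Tprox_subdiff u g0) (Tprox_subdiff w g0).
rewrite -scalerBr (ipZr l2dot_ip) pmulr_rge0 ?invr_gt0// => h.
have -> : u - w = (Tprox g u - Tprox g w) +
    ((u - Tprox g u) - (w - Tprox g w)).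
  by rewrite [RHS]addrACA -opprD !subrKC.
set a := _ - _ in h *; set b := _ - _ in h *.
rewrite (sqr_normD l2dot_ip a b); move: h.
by move: (l2dot a b) (`|a| ^+ 2) (`|b| ^+ 2) => x1 x2 x3 *; lra.
Qed.

Lemma Tprox_nonexpansive (g : R) (u w : l2 R K) : 0 < g ->
  `|Tprox g u - Tprox g w| <= `|u - w|.
Proof.
move=> g0; rewrite -(@ler_pXn2r _ 2) ?nnegrE//.
by apply: le_trans (Tprox_firm u w g0); rewrite lerDl sqr_ge0.
Qed.

End separable.

(** * The primal-dual pair and the forward-backward iteration *)

(** [D] is the distance to a solution, [y] the distance after an error-free step, [E] the decrease
    of its square and [h] the error. Subtracting from [D] the partial sums of [h] leaves a
    nonincreasing sequence bounded below. *)
Lemma quasi_fejer {R : realType} (D E h y : nat -> R) :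
  (forall n, 0 <= D n) -> (forall n, 0 <= E n) -> (forall n, 0 <= h n) ->
  (forall n, 0 <= y n) -> cvgn (series h) ->
  (forall n, y n ^+ 2 + E n <= D n ^+ 2) ->
  (forall n, D n.+1 <= y n + h n) -> cvgn D /\ E @ \oo --> 0.
Proof.
move=> D0 E0 h0 y0 hc yE Dy.
have yD n : y n <= D n.
  rewrite -(@ler_pXn2r _ 2) ?nnegrE//; apply: le_trans (yE n).
  by rewrite lerDl.
have hs n : series h n.+1 = series h n + h n by rewrite seriesSr.
have cD : cvgn D.
  rewrite (_ : D = (fun n => D n - series h n) \+ series h); last first.
    by apply/funext => n /=; rewrite subrK.
  apply: (is_cvgD _ hc); apply: nonincreasing_is_cvgn.
    apply/nonincreasing_seqP => n; rewrite hs.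
    by have := Dy n; have := yD n; lra.
  exists (- limn (series h)) => _ [n _ <-].
  have := D0 n; suff : series h n <= limn (series h) by lra.
  by apply: (nondecreasing_cvgn_le _ hc n); apply: nondecreasing_series => *.
split=> //; have /cvg_ex[l Dl] := cD.
have Dl1 : D n.+1 @[n --> \oo] --> l by rewrite (cvg_shiftS D).
have h1 := cvg_series_cvg_0 hc.
(* The majorant comes from E <= (D - y) (D + y), with D + y <= 2 D and D n - y n <= D n - D n.+1 + h
   n. *)
apply: (@squeeze_cvgr _ _ _ _ (cst 0)
  (fun n => (D n - D n.+1 + h n) * (2 * D n))).
- apply: nearW => n; rewrite /cst E0/=.
  have := yE n; have := Dy n; have := yD n; have := D0 n; have := y0 n.
  move: (D n) (D n.+1) (y n) (h n) (E n) => d d' y' h' E' *.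
  have : 0 <= (d - d' + h' - (d - y')) * (2 * d) by rewrite mulr_ge0//; lra.
  have : 0 <= (d - y') * (d - y') by rewrite -expr2 sqr_ge0.
  nra.
- exact: cvg_cst.
- rewrite -(mul0r (2 * l)) -{1}(addr0 0) -{1}(subrr l).
  apply: cvgM; last exact: cvgMr.
  by apply: cvgD => //; exact: cvgB.
Qed.

Lemma sqr_norm_cvg0 {R : realType} {V : normedModType R} (I : Type)
    (F : set_system I) {FF : Filter F} (a : I -> V) :
  `|a i| ^+ 2 @[i --> F] --> (0 : R) -> a @ F --> 0.
Proof.
move=> a2; apply/cvgr0Pnorm_lt => e e0.
have e2 : 0 < e ^+ 2 by rewrite exprn_gt0.
move/cvgr0Pnorm_lt : a2 => /(_ _ e2); apply: filterS => i.
by rewrite ger0_norm ?sqr_ge0// ltr_pXn2r ?nnegrE ?(ltW e0).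
Qed.

Lemma scale_bounded_cvg0 {R : realType} {V : normedModType R} (I : Type)
    (F : set_system I) {FF : Filter F} (r : I -> R) (a : I -> V) (B : R) :
  (forall i, `|r i| <= B) -> a @ F --> 0 -> r i *: a i @[i --> F] --> 0.
Proof.
move=> rB a0; apply/norm_cvg0P.
apply: (@squeeze_cvgr _ _ _ _ (cst 0) (fun i => B * `|a i|)).
- by apply: nearW => i; rewrite /cst normr_ge0/= normrZ ler_wpM2r.
- exact: cvg_cst.
- rewrite -(mulr0 B); apply: cvgMr; rewrite -(@normr0 _ V).
  exact: cvg_norm.
Qed.

Lemma subrACA {V : zmodType} (a b c d : V) :
  (a - b) - (c - d) = (a - c) - (b - d).
Proof. by rewrite opprD addrACA -opprD. Qed.

(** * The analysis operator L, its adjoint, and the optimality system *)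

Section operators.
Context {R : realType} {H : completeNormedModType R} {K : set nat}.
Variables (dot : H -> H -> R) (ipP : inner_product dot).
Variables (e : nat -> H) (delta : R).
Hypothesis delta_gt0 : 0 < delta.
Hypothesis bessel : forall x : H,
  (\sum_(k <oo | k \in K) (`|dot x (e k)| ^+ 2)%R%:E
     <= (delta * `|x| ^+ 2)%R%:E)%E.

Lemma analysis_subproof (x : H) : exists v : l2 R K,
  (forall k, K k -> v k = dot x (e k)) /\ `|v| ^+ 2 <= delta * `|x| ^+ 2.
Proof.
have [||v [vE vx]] := @l2_mk R K
    (fun k => if k \in K then dot x (e k) else 0) (delta * `|x| ^+ 2).
- by move=> k nKk; case: ifPn => // /set_mem.
- exact: nneseries_partial_sum (bessel x).
by exists v; split=> // k Kk; rewrite vE mem_set.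
Qed.

Definition analysis (x : H) : l2 R K := xget 0 [set v : l2 R K |
  (forall k, K k -> v k = dot x (e k)) /\ `|v| ^+ 2 <= delta * `|x| ^+ 2].

Local Notation L := analysis.

Lemma analysisP (x : H) :
  (forall k, K k -> L x k = dot x (e k)) /\ `|L x| ^+ 2 <= delta * `|x| ^+ 2.
Proof.
rewrite /analysis; case: xgetP => [v _ //|nv].
by have [v vP] := analysis_subproof x; case: (nv v).
Qed.

Lemma analysisE (x : H) k : K k -> L x k = dot x (e k).
Proof. exact: (analysisP x).1. Qed.

Lemma analysis_norm (x : H) : `|L x| ^+ 2 <= delta * `|x| ^+ 2.
Proof. exact: (analysisP x).2. Qed.

Lemma analysisB (x y : H) : L (x - y) = L x - L y.
Proof.
by apply: l2P => k Kk; rewrite l2_addE l2_oppE !analysisE// (ipBl ipP).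
Qed.

Definition synthesis (v : l2 R K) : H := vsum K (fun k => v k *: e k).

Local Notation "L*" := synthesis.

(** Transfers the Bessel bound to the adjoint: |s|^2 is the pairing of [v] with [L s], and Young's
    inequality with weights delta and delta^-1 leaves a term at most |s|^2 to absorb. The lower
    index [m] serves the Cauchy criterion. *)
Lemma synthesis_partial (v : l2 R K) m n (s := \sum_(m <= k < n) v k *: e k) :
  `|s| ^+ 2 <= delta * \sum_(m <= k < n) v k ^+ 2.
Proof.
have sE : `|s| ^+ 2 = \sum_(m <= k < n) v k * L s k.
  rewrite -(ip_sqr ipP) {1}/s (big_morph (dot^~ s) (id1 := 0) (op1 := +%R)).
  - apply: eq_bigr => k _; rewrite (ipZl ipP).
    have [Kk|nKk] := pselect (K k); last by rewrite l2_out// !mul0r.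
    by rewrite analysisE// (ipC ipP).
  - by move=> a b; rewrite (ipDl ipP).
  - exact: ip0l.
have Ls : \sum_(m <= k < n) L s k ^+ 2 <= `|L s| ^+ 2.
  apply: le_trans (l2_partial_sum (L s) n).
  have [mn|nm] := leqP m n; last by rewrite big_geq ?(ltnW nm)// sumr_ge0// =>
    *; exact: sqr_ge0.
  by rewrite (big_cat_nat (leq0n m) mn)/= lerDr sumr_ge0// => *; exact: sqr_ge0.
have := le_trans Ls (analysis_norm s).
have : 2 * `|s| ^+ 2 <= delta * (\sum_(m <= k < n) v k ^+ 2)
    + delta^-1 * \sum_(m <= k < n) L s k ^+ 2.
  rewrite sE !mulr_sumr -big_split/=; apply: ler_sum => k _.
  rewrite -subr_ge0.
  have -> : delta * v k ^+ 2 + delta^-1 * L s k ^+ 2 - 2 * (v k * L s k) =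
      delta^-1 * (delta * v k - L s k) ^+ 2.
    by move: (v k) (L s k) => a b; field; rewrite gt_eqF.
  by rewrite mulr_ge0 ?sqr_ge0// invr_ge0 ltW.
move: (\sum_(m <= k < n) L s k ^+ 2) (\sum_(m <= k < n) v k ^+ 2) => A B.
move=> h1 h2.
have : delta^-1 * A <= `|s| ^+ 2 by rewrite ler_pdivrMl.
by move: h1; move: (delta^-1 * A) => C h1 h3; lra.
Qed.

Lemma synthesis_series (v : l2 R K) :
  (fun n => \sum_(0 <= k < n | k \in K) v k *: e k) =
  series (fun k => v k *: e k).
Proof.
apply/funext => n; rewrite /series/= big_mkcond/=; apply: eq_bigr => k _.
by case: ifPn => // /negP nKk; rewrite l2_out ?scale0r// => /mem_set.
Qed.

Lemma is_cvg_synthesis (v : l2 R K) : cvgn (series (fun k => v k *: e k)).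
Proof.
apply/cauchy_cvgP/cauchy_seriesP => r r0.
have r2 : 0 < r ^+ 2 / delta by rewrite divr_gt0// exprn_gt0.
have : cvgn (series (fun k => v k * v k)) by exact: is_cvg_l2dot.
move=> /cvg_cauchy/cauchy_seriesP/(_ _ r2); apply: filterS => -[m n]/= h.
rewrite -(@ltr_pXn2r _ 2) ?nnegrE ?(ltW r0)//.
apply: (le_lt_trans (synthesis_partial v m n)).
by rewrite mulrC -ltr_pdivlMr//; exact: le_lt_trans (ler_norm _) h.
Qed.

Lemma synthesis_dot (v : l2 R K) (y : H) : dot (L* v) y = l2dot v (L y).
Proof.
rewrite /synthesis /vsum synthesis_series.
pose a := series (fun k => v k *: e k).
have h : dot (a n) y @[n --> \oo] --> dot (limn a) y.
  by apply: (cvg_ip ipP); [exact: is_cvg_synthesis|exact: cvg_cst].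
rewrite -(cvg_lim _ h)// /l2dot; congr (limn _); apply/funext => n.
rewrite /a /series/= (big_morph (dot^~ y) (id1 := 0) (op1 := +%R)).
- apply: eq_bigr => k _; rewrite (ipZl ipP).
  have [Kk|nKk] := pselect (K k); last by rewrite l2_out// !mul0r.
  by rewrite analysisE// (ipC ipP).
- by move=> ? ?; rewrite (ipDl ipP).
- exact: ip0l.
Qed.

Variables (f : H -> \bar R) (z : H) (phi : nat -> R^o -> \bar R).
Hypothesis f_Gamma0 : Gamma0 f.
Hypothesis phiG : forall k, K k -> Gamma0 (phi k).
Hypothesis phi_min : forall k, K k ->
  phi k 0 = 0%E /\ forall t, (phi k 0%R <= phi k t)%E.

Definition kkt (x : H) (v : l2 R K) : Prop :=
  subdiff dot f x (z - L* v - x) /\ sep_subdiff phi (L x) v.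

Lemma kkt_prox x v : kkt x v -> x = prox f (z - L* v).
Proof. by move=> [sf _]; rewrite (prox_subdiff ipP sf). Qed.

(** Add the two subgradient inequalities: the terms in [v] cancel by adjointness, and the expansion
    of |y - z|^2 leaves the surplus |y - x|^2 / 2. *)
Lemma kkt_primal x v : kkt x v -> argmin (primal_obj dot f z K e phi) x.
Proof.
move=> [[fx sf] sp] y; have [S [SE S0 Sge _ _]] := sep_sums phi_min sp.
have LE w : (\sum_(k <oo | k \in K) phi k (dot w (e k)) =
    \sum_(k <oo | k \in K) phi k (L w k))%E.
  by apply: eq_eseriesr => k /set_mem Kk; rewrite analysisE.
rewrite /primal_obj !LE SE -(fineK fx) -!EFinD.
have := leeD (leeD (sf y) (Sge (L y))) (le_refl (2^-1 * `|y - z| ^+ 2)%:E).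
apply: le_trans; rewrite -(fineK fx) -!EFinD lee_fin -analysisB -synthesis_dot.
have -> : y - z = (x - z) + (y - x) by rewrite [RHS]addrC addrA subrK.
rewrite (sqr_normD ipP (x - z)) -!addrA lerD2l.
have -> : dot (z + (- L* v - x)) (y - x) =
    - dot (x - z) (y - x) - dot (L* v) (y - x).
  by rewrite !(ipE ipP); lra.
have := sqr_ge0 `|y - x|.
by move: (dot _ _) (dot _ _) (`|x - z| ^+ 2) => a b c; lra.
Qed.

Lemma kkt_dual x v : kkt x v -> argmin (dual_obj dot f z e phi) v.
Proof.
move=> [sf sp] u; have [S [_ _ _ SE Sge]] := sep_sums phi_min sp.
rewrite /dual_obj -!/(synthesis _) SE (moreau_conjugate_subdiff ipP sf) -EFinD.
apply: le_trans (leeD (moreau_conjugate_ge ipP (z - L* u) (proj1 sf)) (Sge u)).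
rewrite -EFinD lee_fin !(ipBr ipP) !(ipC ipP x (L* _)) !synthesis_dot.
rewrite !(l2dotC _ (L x)).
by move: (l2dot _ _) (l2dot _ _) => a b; lra.
Qed.

Definition xprox (v : l2 R K) : H := prox f (z - L* v).

Lemma xprox_subdiff v : subdiff dot f (xprox v) (z - L* v - xprox v).
Proof. exact: subdiff_prox. Qed.

(** Combined with [analysis_norm], this is the delta^-1-cocoercivity of v |-> - L (xprox v), the
    gradient of the smooth part of the dual objective. *)
Lemma subdiff_xprox_mono x v y w :
  subdiff dot f x (z - L* v - x) -> subdiff dot f y (z - L* w - y) ->
  `|x - y| ^+ 2 <= - l2dot (v - w) (L x - L y).
Proof.
move=> sx sy; have := subdiff_mono ipP sx sy.
rewrite -analysisB (ipBl l2dot_ip) -!synthesis_dot -(ip_sqr ipP).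
have -> : z - L* v - x - (z - L* w - y) = (L* w - L* v) - (x - y).
  by rewrite subrACA (subrACA z) subrr sub0r opprB.
rewrite (ipBl ipP _ (x - y)) (ipBl ipP (L* w)).
by move: (dot _ _) (dot _ _) (dot _ _) => *; lra.
Qed.

Lemma analysis_continuous (I : Type) (F : set_system I) {FF : Filter F}
    (x_ : I -> H) x : x_ @ F --> x -> L (x_ i) @[i --> F] --> L x.
Proof.
move=> xx; apply/cvgrPdist_le => r r0.
have d0 : 0 < r / Num.sqrt delta by rewrite divr_gt0 ?sqrtr_gt0.
move/cvgrPdist_le : xx => /(_ _ d0); apply: filterS => i.
rewrite ler_pdivlMr ?sqrtr_gt0// -analysisB => h; apply: le_trans h.
rewrite -(@ler_pXn2r _ 2) ?nnegrE ?mulr_ge0 ?sqrtr_ge0//.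
by rewrite exprMn (sqr_sqrtr (ltW delta_gt0)) mulrC analysis_norm.
Qed.

Lemma subdiff_f_closed (I : Type) (F : set_system I) {FF : ProperFilter F}
    (v_ : I -> l2 R K) (x_ : I -> H) v x (M : R) :
  (forall i, `|v_ i| <= M) ->
  (forall y, l2dot (v_ i) y @[i --> F] --> l2dot v y) -> x_ @ F --> x ->
  (forall i, subdiff dot f (x_ i) (z - L* (v_ i) - x_ i)) ->
  subdiff dot f x (z - L* v - x).
Proof.
move=> vM vv xx sub; have [fN f0 flsc _] := f_Gamma0.
apply: (subdiff_closed fN f0 flsc sub xx) => w.
have wx : w - x_ i @[i --> F] --> w - x by apply: cvgB => //; exact: cvg_cst.
(* Moving [L*] to the other side pairs the weakly convergent [v_ i] with the norm convergent
   [L (w - x_ i)]. *)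
have E u p : dot (z - L* u - p) (w - p) =
    dot (z - p) (w - p) - l2dot u (L (w - p)).
  by rewrite -synthesis_dot -(ipBl ipP) addrAC.
rewrite E; under eq_fun do rewrite E; apply: cvgB.
  by apply: (cvg_ip ipP) => //; apply: cvgB => //; exact: cvg_cst.
by apply: (l2_weak_strong_cvg vM vv); exact: analysis_continuous.
Qed.

Lemma sep_closed (I : Type) (F : set_system I) {FF : ProperFilter F}
    (xi_ v_ : I -> l2 R K) (xi v : l2 R K) :
  (forall k, xi_ i k @[i --> F] --> xi k) ->
  (forall k, v_ i k @[i --> F] --> v k) ->
  (forall i, sep_subdiff phi (xi_ i) (v_ i)) -> sep_subdiff phi xi v.
Proof.
move=> xx vv sub k Kk; have [pN p0 plsc _] := phiG Kk.
apply: (subdiff_closed pN p0 plsc (fun i => sub i k Kk) (xx k)) => w.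
by apply: cvgM; [exact: vv|apply: cvgB; [exact: cvg_cst|exact: xx]].
Qed.

(* Tikhonov regularization of the dual problem: the forward-backward operator of
   the dual objective increased by [r / 2 |v|^2] is a contraction. *)
Lemma regularized_kkt (r : R) : 0 < r ->
  exists v, sep_subdiff phi (L (xprox v) - r *: v) v.
Proof.
(* delta + r is a Lipschitz constant of the regularized gradient r v - L (xprox v). A gradient step
   of length [g] keeps the coefficient 1 - g r = q of [v], and q = g delta is the contraction
   factor. *)
move=> r0; pose g := (delta + r)^-1; pose q := delta / (delta + r).
have dr : 0 < delta + r by rewrite addr_gt0.
have g0 : 0 < g by rewrite invr_gt0.
have q0 : 0 <= q by rewrite divr_ge0// ltW.
have q1 : q < 1 by rewrite ltr_pdivrMr// mul1r ltrDl.
have gd : g * delta = q by rewrite mulrC.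
pose B v := q *: v + g *: L (xprox v).
have [||v vE] := @l2_contraction R K (fun v => Tprox phi g (B v)) q.
- by rewrite q0.
- move=> u w; apply: le_trans (Tprox_nonexpansive phiG phi_min _ _ g0) _.
  rewrite -(@ler_pXn2r _ 2) ?nnegrE ?(mulr_ge0 q0)// exprMn.
  have := subdiff_xprox_mono (xprox_subdiff u) (xprox_subdiff w).
  have := analysis_norm (xprox u - xprox w); rewrite analysisB.
  set b := L _ - L _; set a := u - w; set t := `|xprox u - xprox w| ^+ 2.
  have -> : B u - B w = q *: a + g *: b.
    by rewrite /B opprD addrACA -!scalerBr.
  have t0 : 0 <= t by rewrite sqr_ge0.
  clearbody a b t.
  rewrite (sqr_normD l2dot_ip (q *: a) (g *: b)) (sqr_normZ l2dot_ip q a).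
  rewrite (sqr_normZ l2dot_ip g b) (ipZl l2dot_ip) (ipZr l2dot_ip) => h1 h2.
  have h3 : g ^+ 2 * `|b| ^+ 2 <= g * (q * t).
    by rewrite expr2 -mulrA ler_pM2l// -gd -mulrA ler_pM2l.
  have h4 : q * (g * l2dot a b) <= - (g * (q * t)).
    by rewrite mulrCA -mulrN ler_pM2l// -mulrN ler_wpM2l// lerNr.
  have h5 : 0 <= g * (q * t) by rewrite !mulr_ge0// ltW.
  move: h3 h4 h5; move: (g * (q * t)) (q * (g * l2dot a b)).
  by move: (g ^+ 2 * `|b| ^+ 2) (q ^+ 2 * `|a| ^+ 2) => A1 A2 A3 A4; lra.
exists v; have := Tprox_subdiff phiG phi_min (B v) g0; rewrite vE.
rewrite (_ : g^-1 *: (B v - v) = L (xprox v) - r *: v)//.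
apply: l2P => k _; rewrite /B !(l2_addE, l2_oppE, l2_scaleE).
by move: (v k) (L _ k) => s t; rewrite /g /q; field; rewrite gt_eqF.
Qed.

(** Adding the subgradient inequalities at [y] and [eta] leaves |x|^2 plus terms affine in x = xprox
    v, once f(x) is minorized by its affine minorant at p = prox f 0. Young's inequality absorbs
    them, and r |v|^2 has the favourable sign, so [C] depends on neither [r] nor [v]. *)
Lemma dual_minorant (y : H) (eta : l2 R K) : dom f y ->
  (\sum_(k <oo | k \in K) phi k (eta k) < +oo)%E ->
  exists C, forall r v, 0 < r -> sep_subdiff phi (L (xprox v) - r *: v) v ->
    C <= l2dot v (L y - eta).
Proof.
move=> fy Pfin.
have : (0 <= \sum_(k <oo | k \in K) phi k (eta k))%E.
  by apply: nneseries_ge0 => k _ /set_mem/phi_min[<-].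
move: Pfin; case PE : (\sum_(k <oo | k \in K) phi k (eta k))%E => [P||]// _ _.
have {}fy : f y \is a fin_num.
  by move: fy; rewrite /dom/= fin_numE;
    have [/(_ y) -> _ _ _ /lt_eqF ->] := f_Gamma0.
pose p := prox f 0; pose c := p + z + y.
have [fp sp] : subdiff dot f p (0 - p) by exact: subdiff_prox.
exists (fine (f p) + `|p| ^+ 2 + dot z y - 2^-1 * `|c| ^+ 2 - fine (f y) - P).
move=> r v r0 sv; have [S [_ S0 /(_ eta) + _ _]] := sep_sums phi_min sv.
rewrite PE lee_fin; have [fx /(_ y)] := xprox_subdiff v.
have := sp (xprox v); set x := xprox v.
rewrite -(fineK fx) -(fineK fp) -(fineK fy) -!EFinD !lee_fin.
have -> : l2dot v (eta - (L x - r *: v)) =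
    l2dot v eta - l2dot v (L x) + r * `|v| ^+ 2.
  by rewrite !(ipBr l2dot_ip) (ipZr l2dot_ip) l2_norm_dot; lra.
have -> : dot (z - L* v - x) (y - x) = dot (z - x) (y - x)
    - l2dot v (L y) + l2dot v (L x).
  by rewrite -!synthesis_dot !(ipE ipP); lra.
rewrite (ipBr l2dot_ip) => h1 h2 h3.
have h4 : 0 <= r * `|v| ^+ 2 by rewrite mulr_ge0 ?sqr_ge0// ltW.
have := sqr_ge0 `|x|; have := ip_young ipP c x.
have -> : dot c x = dot p x + dot z x + dot y x by rewrite !(ipDl ipP).
move: h1 h2; rewrite !(ipE ipP) !(ip_sqr ipP) (ipC ipP x y).
move: h3 h4; move: (r * _) (l2dot v eta) (l2dot v (L x)) (l2dot v (L y)).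
move: (dot z y) (dot z x) (dot y x) (dot p x) (`|c| ^+ 2).
move: (`|x| ^+ 2) (`|p| ^+ 2) (fine _) (fine _) (fine _).
by move=> /= *; lra.
Qed.

Hypothesis qualif : sri (@qualification_set R H dot f K e phi) 0.

Lemma kkt_exists : exists x v, kkt x v.
Proof.
have hpos n : 0 < (n.+1%:R : R)^-1 by rewrite invr_gt0.
have /choice[v vP] : forall n, exists v,
    sep_subdiff phi (L (xprox v) - n.+1%:R^-1 *: v) v.
  by move=> n; exact: regularized_kkt.
pose x n := xprox (v n); pose xi n := L (x n) - n.+1%:R^-1 *: v n.
pose D := [set y - 0 | y in @qualification_set R H dot f K e phi].
have vD n : D (n.+1%:R^-1 *: v n).
  have [S [SE _ _ _ _]] := sep_sums phi_min (vP n).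
  exists (n.+1%:R^-1 *: v n); last by rewrite subr0.
  exists (x n), (xi n); split.
  - by have [fx _] := xprox_subdiff (v n); rewrite /dom/= ltey_eq fx.
  - by rewrite /xi SE ltry.
  - by move=> k Kk; rewrite -analysisE// -l2_oppE -l2_addE /xi subKr.
have [M vM] : exists M, forall n, `|v n| <= M.
  have [|M h] := @l2_uniform_boundedness _ _ (range v); last first.
    by exists M => n; apply: h; exists n.
  move=> w /(closureS (lin_span_sub_scale _)) => /(_ D) clw.
  have : closure (lin_span D) w.
    apply: clw => _ [n _ <-]; exists n.+1%:R, (n.+1%:R^-1 *: v n); split=> //.
    by rewrite scalerA divff// scale1r.
  (* Here the strong relative interior acts: every [w] of the closed span is a positive multiple of
     an element of the qualification set, where [dual_minorant] applies. *)
  have [_ <-] := qualif; move=> [l /= l0 [d [d' [y [eta [fy Pf dE]]] <-]] <-].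
  have {dE} -> : d' = L y - eta.
    by apply: l2P => k Kk; rewrite dE// l2_addE l2_oppE analysisE.
  have [C hC] := dual_minorant fy Pf.
  exists (l * C) => _ [n _ <-]; rewrite (ipZr l2dot_ip) subr0 ler_pM2l//.
  by apply: hC (vP n).
(* Both monotonicity relations bound |x n - x m|^2 by - <v n - v m, r_n v n - r_m v m>; the squares
   have the good sign and the cross terms are at most M^2 (r_n + r_m). *)
have /cvg_ex[xb xx] : cvgn x.
  apply: (@cvgn_sqr_harmonic _ _ _ (M ^+ 2)) => n m.
  have := sep_subdiff_mono (vP n) (vP m).
  have := subdiff_xprox_mono (xprox_subdiff (v n)) (xprox_subdiff (v m)).
  rewrite -/(x n) -/(x m).
  have -> : L (x n) - n.+1%:R^-1 *: v n - (L (x m) - m.+1%:R^-1 *: v m) =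
      (L (x n) - L (x m)) - (n.+1%:R^-1 *: v n - m.+1%:R^-1 *: v m).
    exact: subrACA.
  rewrite (ipBr l2dot_ip _ (L (x n) - L (x m))).
  move: (l2dot _ (L (x n) - L (x m))) => X h1.
  rewrite (ipBr l2dot_ip) !(ipBl l2dot_ip) !(ipZr l2dot_ip) !l2_norm_dot.
  rewrite (l2dotC (v m) (v n)) => h2.
  have G : l2dot (v n) (v m) <= M ^+ 2.
    apply: le_trans (ler_norm _) _; apply: le_trans (ip_norm l2dot_ip _ _) _.
    by rewrite expr2 ler_pM.
  apply: (le_trans h1); move: h2 G (hpos n) (hpos m).
  have := sqr_ge0 `|v n|; have := sqr_ge0 `|v m|.
  move: (n.+1%:R^-1) (m.+1%:R^-1) (l2dot _ _) (`|v n| ^+ 2) (`|v m| ^+ 2).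
  move: (M ^+ 2) => M2 r1 r2 G A B A0 B0 h2 GM r10 r20.
  have : 0 <= r1 * (M2 - G) by rewrite mulr_ge0 ?subr_ge0// ltW.
  have : 0 <= r2 * (M2 - G) by rewrite mulr_ge0 ?subr_ge0// ltW.
  have : 0 <= r1 * A by rewrite mulr_ge0// ltW.
  have : 0 <= r2 * B by rewrite mulr_ge0// ltW.
  by move: h2; lra.
have [U [UU oU]] := ultraFilterLemma eventually_filter.
have UP : ProperFilter U by exact: ultra_proper.
have [vb [_ vv]] := @l2_weak_compact _ _ _ U _ v M vM.
have xU : x @ U --> xb by move=> A /xx; exact: oU.
exists xb, vb; split.
  by apply: (subdiff_f_closed vM vv xU) => n; exact: xprox_subdiff.
apply: (@sep_closed _ U _ xi v) => // k; last exact: l2_weak_coord.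
apply: l2_cvg_coord; rewrite -[L xb]subr0; apply: cvgB.
  exact: analysis_continuous.
apply: (l2_bounded_cvg0 vM) => A /(@cvg_harmonic R); exact: oU.
Qed.

(** The first gain comes from g (2 / delta - g) delta >= eps^2 delta, both margins of the step size
    being at least [eps]; it drives the primal convergence. The second comes from monotonicity of
    the proximal step and later forces v - p to 0. *)
Lemma fb_step (xb : H) (vb v : l2 R K) (g eps : R)
    (p := Tprox phi g (v + g *: L (xprox v))) :
  0 < eps -> eps <= g <= 2 * delta^-1 - eps -> kkt xb vb ->
  `|p - vb| ^+ 2 + (eps ^+ 2 * delta * `|xprox v - xb| ^+ 2
     + `|(v - p) + g *: (L (xprox v) - L xb)| ^+ 2) <= `|v - vb| ^+ 2.
Proof.
move=> eps0 /andP[eg ge] [sf sp]; have g0 : 0 < g by exact: lt_le_trans eg.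
have := sep_subdiff_mono (Tprox_subdiff phiG phi_min _ g0) sp.
move=> /(_ (v + g *: L (xprox v))); rewrite -/p.
have := subdiff_xprox_mono (xprox_subdiff v) sf.
have := analysis_norm (xprox v - xb); rewrite analysisB.
set b := L _ - L _; set d := v - vb; set t := `|xprox v - xb| ^+ 2.
set u := (v - p) + g *: b => h1 h2.
have -> : g^-1 *: (v + g *: L (xprox v) - p) - L xb = g^-1 *: u.
  apply: l2P => k _; rewrite /u /b !(l2_addE, l2_oppE, l2_scaleE).
  by move: (v k) (p k) (L _ k) (L _ k) => *; field; rewrite gt_eqF.
rewrite (ipZr l2dot_ip) pmulr_rge0 ?invr_gt0// => h3.
have t0 : 0 <= t by rewrite sqr_ge0.
(* The same vector d + g b is split as (p - vb) + u; expanding its square both ways links the old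
   and the new distance. *)
have E1 : `|d + g *: b| ^+ 2 = `|p - vb| ^+ 2 + 2 * l2dot
  (p - vb) u + `|u| ^+ 2.
  rewrite -(sqr_normD l2dot_ip (p - vb) u); congr (`| _ | ^+ 2).
  by rewrite /u /d addrA [p - vb + _]addrC addrA subrK.
clearbody b d t u p.
have := sqr_normD l2dot_ip d (g *: b).
rewrite E1 (ipZr l2dot_ip) (sqr_normZ l2dot_ip g b) => E2.
have h4 : g ^+ 2 * `|b| ^+ 2 <= g ^+ 2 * (delta * t)
  by rewrite ler_wpM2l ?sqr_ge0.
have h5 : g * l2dot d b <= - (g * t) by rewrite -mulrN ler_pM2l// lerNr.
have h6 : eps ^+ 2 * delta * t <= 2 * (g * t) - g ^+ 2 * (delta * t).
  rewrite (_ : 2 * (g * t) - _ = g * (2 * delta^-1 - g) * delta * t);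
    last first.
    by field; rewrite gt_eqF.
  rewrite ler_wpM2r// ler_wpM2r ?(ltW delta_gt0)// expr2.
  by apply: ler_pM; rewrite ?(ltW eps0)//; lra.
move: E2 h3 h4 h5 h6.
move: (l2dot _ _) (g * l2dot d b) (g ^+ 2 * `|b| ^+ 2) (g ^+ 2 * (delta * t)).
move: (eps ^+ 2 * delta * t) (g * t) (`|p - vb| ^+ 2) (`|u| ^+ 2) (`|d| ^+ 2).
by move=> *; lra.
Qed.

Lemma sqr_norm_convex (l : R) (a b : l2 R K) : 0 <= l <= 1 ->
  `|(1 - l) *: a + l *: b| ^+ 2 <= (1 - l) * `|a| ^+ 2 + l * `|b| ^+ 2.
Proof.
move=> /andP[l0 l1]; rewrite (sqr_normD l2dot_ip ((1 - l) *: a) (l *: b)).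
rewrite (sqr_normZ l2dot_ip (1 - l) a) (sqr_normZ l2dot_ip l b).
rewrite (ipZl l2dot_ip) (ipZr l2dot_ip).
have := ip_young l2dot_ip a b.
move: (l2dot a b) (`|a| ^+ 2) (`|b| ^+ 2) => x y w h.
have : 0 <= (1 - l) * l * (y + w - 2 * x) by rewrite !mulr_ge0 ?subr_ge0.
by lra.
Qed.

(** * Convergence of the inexact forward-backward iteration *)

Section algorithm.
Variables (eps : R) (gamma lambda : nat -> R) (v a : nat -> l2 R K).
Variables (b : nat -> H).
Hypothesis eps_gt0 : 0 < eps.
Hypothesis gamma_itv : forall n, eps <= gamma n <= 2 * delta^-1 - eps.
Hypothesis lambda_itv : forall n, eps <= lambda n <= 1.
Hypothesis a_sum : cvgn (series (fun n => `|a n|)).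
Hypothesis b_sum : cvgn (series (fun n => `|b n|)).
Hypothesis v_rec : forall n, v n.+1 = v n + lambda n *:
  (Tprox phi (gamma n) (v n + gamma n *: L (xprox (v n) + b n)) + a n - v n).

Let p n := Tprox phi (gamma n) (v n + gamma n *: L (xprox (v n))).

Let gamma_gt0 n : 0 < gamma n.
Proof. by have /andP[h _] := gamma_itv n; exact: lt_le_trans h. Qed.

Lemma fb_fejer (xb : H) (vb : l2 R K) : kkt xb vb ->
  [/\ cvgn (fun n => `|v n - vb|), xprox (v n) @[n --> \oo] --> xb &
      v n - p n @[n --> \oo] --> 0].
Proof.
move=> kk.
(* The leading [eps] is the lower bound on [lambda n], since relaxation keeps only that fraction of
   the decrease. *)
pose E n := eps * (eps ^+ 2 * delta * `|xprox (v n) - xb| ^+ 2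
  + `|(v n - p n) + gamma n *: (L (xprox (v n)) - L xb)| ^+ 2).
(* The error [b n] passes through [gamma n], at most 2 / delta, and through L, of norm at most sqrt
   delta; [Tprox] and [lambda n] do not enlarge it. *)
pose h n := `|a n| + 2 * delta^-1 * Num.sqrt delta * `|b n|.
have c1 : 0 < eps ^+ 2 * delta by rewrite mulr_gt0// exprn_gt0.
have descent (l P V t : R) : eps <= l -> 0 <= t -> P + t <= V ->
    (1 - l) * V + l * P + eps * t <= V.
  move=> el t0 PV; have l0 : 0 < l by exact: lt_le_trans el.
  have : eps * t <= l * t by rewrite ler_wpM2r.
  have : l * (P + t) <= l * V by rewrite ler_pM2l.
  by lra.
have [|||||||cD E0] := @quasi_fejer R (fun n => `|v n - vb|) E h
  (fun n => `|(1 - lambda n) *: (v n - vb) + lambda n *: (p n - vb)|).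
- by [].
- move=> n; apply: mulr_ge0 (ltW eps_gt0) _; apply: addr_ge0 (sqr_ge0 _).
  exact: mulr_ge0 (ltW c1) (sqr_ge0 _).
- move=> n; apply: addr_ge0 => //; apply: mulr_ge0 => //.
  by apply: mulr_ge0 (sqrtr_ge0 _); rewrite mulr_ge0// invr_ge0 ltW.
- by [].
- rewrite (_ : h = (fun n => `|a n|) +
      (2 * delta^-1 * Num.sqrt delta) *: (fun n => `|b n|)).
    by apply: is_cvg_seriesD => //; exact: is_cvg_seriesZ.
  by apply/funext.
- move=> n; have /andP[l0 l1] := lambda_itv n.
  have l0' : 0 < lambda n by exact: lt_le_trans l0.
  have l01 : 0 <= lambda n <= 1 by rewrite (ltW l0').
  apply: le_trans (lerD (sqr_norm_convex _ _ l01) (lexx _)) _.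
  apply: descent (fb_step (v n) eps_gt0 (gamma_itv n) kk) => //.
  by apply: addr_ge0 (sqr_ge0 _); exact: mulr_ge0 (ltW c1) (sqr_ge0 _).
- move=> n; have /andP[l0 l1] := lambda_itv n.
  have l0' : 0 <= lambda n by exact: le_trans (ltW eps_gt0) l0.
  pose q := Tprox phi (gamma n) (v n + gamma n *: L (xprox (v n) + b n)).
  rewrite (_ : v n.+1 - vb = (1 - lambda n) *: (v n - vb)
      + lambda n *: (p n - vb) + lambda n *: ((q - p n) + a n)); last first.
    apply: l2P => k _; rewrite v_rec -/q.
    rewrite !(l2_addE, l2_oppE, l2_scaleE).
    by move: (v n k) (p n k) (q k) (a n k) (vb k) => *; ring.
  apply: le_trans (ler_normD _ _) _; rewrite lerD2l normrZ ger0_norm//.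
  apply: (@le_trans _ _ `|(q - p n) + a n|); first by rewrite ler_piMl.
  apply: le_trans (ler_normD _ _) _; rewrite addrC /h lerD2l.
  apply: le_trans (Tprox_nonexpansive phiG phi_min _ _ (gamma_gt0 n)) _.
  rewrite opprD addrACA subrr add0r -scalerBr -analysisB addrAC subrr add0r.
  rewrite normrZ gtr0_norm// -mulrA ler_pM ?(ltW (gamma_gt0 n))//.
    have /andP[_ h1] := gamma_itv n; apply: (le_trans h1).
    by rewrite gerBl ltW.
  rewrite -(@ler_pXn2r _ 2) ?nnegrE ?mulr_ge0 ?sqrtr_ge0//.
  by rewrite exprMn (sqr_sqrtr (ltW delta_gt0)) analysis_norm.
have c0 : 0 < eps * (eps ^+ 2 * delta) by exact: mulr_gt0.
have xx : xprox (v n) @[n --> \oo] --> xb.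
  apply: cvg_zero; apply: (sqr_norm_cvg0 (a := fun n => xprox (v n) - xb)).
  apply: (@squeeze_cvgr _ _ _ _ (cst 0) (fun n => (eps *
    (eps ^+ 2 * delta))^-1 * E n)).
  - apply: nearW => n; rewrite /cst sqr_ge0/= ler_pdivlMl// -mulrA /E.
    by rewrite ler_pM2l// lerDl sqr_ge0.
  - exact: cvg_cst.
  - by rewrite -(mulr0 (eps * (eps ^+ 2 * delta))^-1); exact: cvgMr.
split=> //; pose B n := L (xprox (v n)) - L xb.
rewrite (_ : (fun n => _) = (fun n => (v n - p n + gamma n *: B n)
    - gamma n *: B n)); last by apply/funext => n; rewrite addrK.
rewrite -[0]subr0; apply: cvgB.
  apply: sqr_norm_cvg0.
  apply: (@squeeze_cvgr _ _ _ _ (cst 0) (fun n => eps^-1 * E n)).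
  - apply: nearW => n; rewrite /cst sqr_ge0/= ler_pdivlMl// /E ler_pM2l//.
    by rewrite lerDr; exact: mulr_ge0 (ltW c1) (sqr_ge0 _).
  - exact: cvg_cst.
  - by rewrite -(mulr0 eps^-1); exact: cvgMr.
apply: (@scale_bounded_cvg0 _ _ _ _ _ _ _ (2 * delta^-1)).
  move=> n; have /andP[_ gle] := gamma_itv n.
  by rewrite ger0_norm ?(ltW (gamma_gt0 n))// (le_trans gle)// gerBl ltW.
rewrite -(subrr (L xb)); apply: cvgB; last exact: cvg_cst.
exact: analysis_continuous.
Qed.

Lemma fb_convergence (xb : H) : (exists vb, kkt xb vb) ->
  xprox (v n) + b n @[n --> \oo] --> xb /\
  exists w, kkt xb w /\ weak_cvg l2dot v w.
Proof.
move=> [vb kk]; have [cD xx pp] := fb_fejer kk; split.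
  rewrite -[xb]addr0; apply: cvgD => //.
  by apply/norm_cvg0P; exact: cvg_series_cvg_0.
have [M vM] : exists M, forall n, `|v n| <= M.
  have /pinfty_ex_gt0[M _ hM] := cvg_seq_bounded cD.
  exists (M + `|vb|) => n; rewrite -[v n](subrK vb).
  apply: (le_trans (ler_normD _ _)); rewrite lerD2r.
  by apply: le_trans (hM n Logic.I); exact: ler_norm.
apply: (l2_opial vM) => [w kw|U w UU oU vw].
  have [cDw _ _] := fb_fejer kw; exact: is_cvgM.
have UP : ProperFilter U by exact: ultra_proper.
have xU : xprox (v n) @[n --> U] --> xb by move=> A /xx; exact: oU.
have pU : v n - p n @[n --> U] --> 0 by move=> A /pp; exact: oU.
split; first by apply: (subdiff_f_closed vM vw xU) => n; exact: xprox_subdiff.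
(* The proximal step provides a subgradient relation at [p n], not at [v n]; since v n - p n tends
   to 0, the weak limit is the same, and [xi n] tends to [L xb]. *)
pose xi n := (gamma n)^-1 *: (v n + gamma n *: L (xprox (v n)) - p n).
apply: (@sep_closed _ U _ xi p) => [k|k|n].
- apply: l2_cvg_coord.
  rewrite (_ : xi = fun n => (gamma n)^-1 *: (v n - p n) + L (xprox (v n))).
    rewrite -[L xb]add0r; apply: cvgD; last exact: analysis_continuous.
    apply: (@scale_bounded_cvg0 _ _ _ _ _ _ _ eps^-1 _ pU) => n.
    have /andP[h1 _] := gamma_itv n.
    by rewrite ger0_norm ?invr_ge0 ?(ltW (gamma_gt0 n))// lef_pV2 ?posrE.
  apply/funext => n; rewrite /xi [v n + _ - _]addrAC scalerDr scalerA.
  by rewrite mulVf ?gt_eqF// scale1r.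
- rewrite (_ : (fun n => p n k) = fun n => v n k - (v n - p n) k).
    rewrite -[w k]subr0; apply: cvgB; first exact: l2_weak_coord.
    exact: (l2_cvg_coord pU).
  by apply/funext => n; rewrite l2_addE l2_oppE subKr.
- exact: Tprox_subdiff.
Qed.

End algorithm.

End operators.

Lemma dot_inner_product {R : realType} {H : normedModType R}
    (dot : {dot H for idfun}) :
  (forall x : H, dot x x = `|x| ^+ 2) -> inner_product dot.
Proof.
move=> dn; split=> // [u v|u v w|a v w].
- by rewrite hermC expr0 mul1r.
- exact: linearDl.
- exact: linearZl_LR.
Qed.

Lemma eq_vsum {R : realType} {V : normedModType R} (K : set nat)
    (u w : nat -> V) : (forall k, K k -> u k = w k) -> vsum K u = vsum K w.
Proof.
move=> uw; congr (limn _); apply/funext => n.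
by apply: eq_bigr => k /set_mem; exact: uw.
Qed.

Theorem proposition4p10 (R : realType)
  (H : completeNormedModType R) (dot : {dot H for idfun})
  (dot_norm : forall x : H, dot x x = `|x| ^+ 2)
  (z : H) (f : H -> \bar R) (f_Gamma0 : Gamma0 f)
  (K : set nat) (K_neq0 : K !=set0)
  (e : nat -> H) (e_unit : forall k, K k -> `|e k| = 1)
  (delta : R) (delta_gt0 : 0 < delta)
  (bessel : forall x : H,
    (\sum_(k <oo | k \in K) (`|dot x (e k)| ^+ 2)%R%:E
       <= (delta * `|x| ^+ 2)%R%:E)%E)
  (phi : nat -> R^o -> \bar R)
  (phi_Gamma0 : forall k, K k -> Gamma0 (phi k))
  (phi_min : forall k, K k -> phi k 0 = 0%E /\ forall t,
    (phi k 0%R <= phi k t)%E)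
  (qualif : sri (@qualification_set R H dot f K e phi) 0)
  (x : H) (x_sol : argmin (primal_obj dot f z K e phi) = [set x])
  (alpha : nat -> nat -> R)
  (alpha_sum : (\sum_(0 <= n <oo)
     sqrte (\sum_(k <oo | k \in K) (`|alpha n k| ^+ 2)%R%:E) < +oo)%E)
  (b : nat -> H) (b_sum : (\sum_(0 <= n <oo) (`|b n|)%:E < +oo)%E)
  (eps : R) (eps_itv : 0 < eps < Num.min 1 delta^-1)
  (gamma : nat -> R)
  (gamma_itv : forall n, eps <= gamma n <= 2 * delta^-1 - eps)
  (lambda : nat -> R) (lambda_itv : forall n, eps <= lambda n <= 1)
  (nu : nat -> nat -> R) (x_ : nat -> H)
  (nu0 : exists v0 : l2 R K, forall k, K k -> v0 k = nu 0%N k)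
  (x_def : forall n,
    x_ n = prox f (z - vsum K (fun k => nu n k *: e k)) + b n)
  (nu_def : forall n k, K k ->
    nu n.+1 k = nu n k + lambda n *
      (prox (fun t : R^o => ((gamma n)%:E * conjugateR (phi k) t)%E)
         (nu n k + gamma n * dot (x_ n) (e k)) + alpha n k - nu n k)) :
  (exists v : nat -> l2 R K,
     (forall n k, K k -> v n k = nu n k) /\
     exists nubar : l2 R K,
       [/\ weak_cvg l2dot v nubar,
           argmin (@dual_obj R H dot f z K e phi) nubar &
           x = prox f (z - vsum K (fun k => nubar k *: e k))])
  /\ x_ n @[n --> \oo] --> x.
Proof.
have ipP := dot_inner_product dot_norm.
have b_cvg : cvgn (series (fun n => `|b n|)).
  exact: nnseries_is_cvg.
have /choice[a aP] : forall n, exists w : l2 R K,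
    (forall k, K k -> w k = alpha n k) /\
    ((`|w|)%:E <= sqrte (\sum_(k <oo | k \in K) (`|alpha n k| ^+ 2)%:E))%E.
  move=> n; set s := (\sum_(k <oo | k \in K) (`|alpha n k| ^+ 2)%:E)%E.
  have s0 : (0 <= s)%E by apply: nneseries_ge0 => k _ _;
    rewrite lee_fin sqr_ge0.
  have : (sqrte s < +oo)%E.
    (* One infinite row norm would make the whole nonnegative series infinite, so each row of
       [alpha] is an element of l2. *)
    rewrite ltey; apply/eqP => sy; move: alpha_sum.
    by rewrite (@nneseries_pinfty _ _ _ n)// => k _; exact: sqrte_ge0.
  case sE : s s0 => [r||]//= s0 _.
  have [||w [wE wr]] := @l2_mk R K (fun k =>
    if k \in K then alpha n k else 0) r.
  - by move=> k nKk; case: ifPn => // /set_mem.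
  - by apply: nneseries_partial_sum; rewrite -/s sE.
  exists w; split; first by move=> k Kk; rewrite wE mem_set.
  by rewrite lee_fin -(ger0_norm (normr_ge0 w)) -sqrtr_sqr ler_wsqrtr.
have a_cvg : cvgn (series (fun n => `|a n|)).
  apply: nnseries_is_cvg => //; apply: le_lt_trans alpha_sum.
  by apply: lee_nneseries => [n _ _|n _]; [rewrite lee_fin|exact: (aP n).2].
have eps_gt0 : 0 < eps by case/andP: eps_itv.
have [v0 v0E] := nu0.
(* Since [nu n] is unconstrained outside [K], the iteration is rebuilt inside l2 and identified with
   [nu] on [K] by induction. *)
have [v [v0' v_rec]] : exists v : nat -> l2 R K, v 0%N = v0 /\
    forall n, v n.+1 = v n + lambda n *: (Tprox phi (gamma n)
      (v n + gamma n *: analysis dot e delta (xprox e f z (v n) + b n))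
      + a n - v n).
  pose fb n (w : l2 R K) := w + lambda n *: (Tprox phi (gamma n)
    (w + gamma n *: analysis dot e delta (xprox e f z w + b n)) + a n - w).
  by exists (fix v n := if n is m.+1 then fb m (v m) else v0).
have xE n : (forall k, K k -> v n k = nu n k) -> x_ n = xprox e f z (v n) + b n.
  move=> vE; rewrite x_def (eq_vsum (w := fun k => v n k *: e k))// => k Kk.
  by rewrite vE.
have vE n k : K k -> v n k = nu n k.
  elim: n k => [|n IH] k Kk; first by rewrite v0' v0E.
  have /andP[eg _] := gamma_itv n.
  rewrite nu_def// (xE n IH)// -IH// -(aP n).1//.
  rewrite v_rec !(l2_addE, l2_scaleE, l2_oppE) TproxE ?(lt_le_trans eps_gt0)//.
  by rewrite l2_addE l2_scaleE (analysisE bessel).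
have [xb [vb kk]] :=
  kkt_exists ipP delta_gt0 bessel z f_Gamma0 phi_Gamma0 phi_min qualif.
(* The primal point of the constructed pair solves the primal problem, whose only solution is
   [x]. *)
have xbE : xb = x.
  have := kkt_primal ipP delta_gt0 bessel phi_min kk.
  by rewrite x_sol.
rewrite {}xbE in kk.
have kkx : exists w : l2 R K, kkt dot e delta f z phi x w by exists vb.
have [xx [w [kw vw]]] := fb_convergence ipP delta_gt0 bessel f_Gamma0
  phi_Gamma0 phi_min eps_gt0 gamma_itv lambda_itv a_cvg b_cvg
  v_rec kkx.
split; last first.
  rewrite (_ : x_ = fun n => xprox e f z (v n) + b n)//.
  by apply/funext => n; apply: xE => k; exact: vE.
exists v; split; first by move=> n k; exact: vE.
exists w; split=> //; first exact: (kkt_dual ipP delta_gt0 bessel phi_min kw).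
exact: (kkt_prox ipP kw).
Qed.
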